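(* Let $G$ and $H$ be simple $3$-connected graphs such that $G$ is not isomorphic to a wheel $W_{n-1}$ ($n \ge 4$), $H \not\cong W_3$, $G$ has a proper $H$-minor, and $G$ has no $H$-deletable edges. Then there exists a simple $3$-connected graph $G'$ with an $H$-minor, but with no $H$-deletable edges, such that one of the following holds: (i) $G = G'\circ f$; (ii) $G = (G'+e)\circ f$, where $e$ and $f$ are in a triad of $G$; or (iii) $G = (G'+\{e_1,e_2\})\circ f$, where $\{e_1,e_2,f\}$ is a triad of $G$. Moreover, $|V(G)| = |V(G')|+1$ and $|E(G)| \le |E(G')|+3$.
   Context: Graphs are finite and may have loops and multiple edges; a graph is simple if it has none. A graph with at least 4 vertices is $3$-connected if at least 3 vertices must be removed to disconnect it; by convention $K_4$ is $3$-connected. $W_{n-1}$ ($n\ge 4$) is the wheel with $n$ vertices and $n-1$ spokes, so $W_3 = K_4$. $H$ is a minor of $G$ if $H$ can be obtained from $G$ by deleting or contracting edges; $G$ has an $H$-minor if it has a minor isomorphic to $H$, and the $H$-minor is proper if $G\not\cong H$. For a $3$-connected graph $G$ with an $H$-minor, an edge $e$ of $G$ is called $H$-deletable if $G\backslash e$ (deletion of $e$) is $3$-connected and has an $H$-minor. $G+e$ (edge addition) denotes $G$ with an edge $e$ added between two non-adjacent vertices; $G+\{e_1,e_2\}$ denotes the graph obtained by adding two such edges. $G\circ f$ (vertex split) denotes any graph obtained from $G$ by choosing a vertex $v$ with $\deg_G(v)\ge 4$, replacing $v$ by two vertices $v_1,v_2$ and a new edge $f=v_1v_2$, and assigning each edge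 originally incident to $v$ to one of $v_1,v_2$ so that both $v_1$ and $v_2$ have degree at least 3. Edges keep their names under vertex splitting. A triad is the set of three edges incident to a degree $3$ vertex. *)

(* Defs.v *)
From mathcomp Require Import all_boot.

Set Implicit Arguments.
Unset Strict Implicit.
Unset Printing Implicit Defensive.

(* A finite graph, with loops and multiple edges allowed: an edge has two ends,
   or a single one when it is a loop. *)
Record graph := Graph {
  vert : finType;
  edge : finType;
  ends : edge -> {set vert};
  ends_card : forall e, 0 < #|ends e| <= 2
}.

Lemma ends_card_set2 (T : finType) (x y : T) : 0 < #|[set x; y]| <= 2.
Proof. by rewrite cards2; case: (x == y). Qed.

Lemma ends_card_imset (T U : finType) (f : T -> U) (A : {set T}) :
  0 < #|A| <= 2 -> 0 < #|f @: A| <= 2.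
Proof.
case/andP=> A0 A2; rewrite (leq_trans (leq_imset_card f A) A2) andbT.
by move: A0; rewrite !card_gt0 imset_eq0.
Qed.

Section Graphs.
Variable G : graph.

Definition simple : Prop :=
  (forall e : edge G, #|ends e| = 2) /\ injective (@ends G).

Definition adjacent (x y : vert G) : bool :=
  [exists e : edge G, ends e == [set x; y]].

Definition nonadjacent (x y : vert G) : bool := (x != y) && ~~ adjacent x y.

Definition incident (x : vert G) : {set edge G} := [set e | x \in ends e].

(* A loop contributes 2 to the degree of its end. *)
Definition degree (x : vert G) : nat :=
  #|incident x| + #|[set e : edge G | ends e == [set x]]|.

Definition triad (T : {set edge G}) : Prop :=
  #|T| = 3 /\ exists2 x : vert G, degree x = 3 & T = incident x.

Definition connected_without (S : {set vert G}) : Prop :=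
  forall x y, x \notin S -> y \notin S ->
  connect [rel a b | [&& a \notin S, b \notin S & adjacent a b]] x y.

(* Holds for K_4, since removing vertices never disconnects it. *)
Definition three_connected : Prop :=
  4 <= #|vert G| /\
  forall S : {set vert G}, ~ connected_without S -> 3 <= #|S|.

Definition delete (e : edge G) : graph :=
  @Graph (vert G) {e' : edge G | e' != e} (fun e' => ends (val e'))
    (fun e' => ends_card (val e')).

(* The vertices of G/e are the classes of the vertices of G once the ends of e
   are identified; contracting a loop amounts to deleting it. *)
Definition contract_class (e : edge G) (x : vert G) : {set vert G} :=
  if x \in ends e then ends e else [set x].

Definition contract_vert (e : edge G) : finType :=
  {B : {set vert G} | B \in [set contract_class e x | x : vert G]}.

Lemma contract_classP (e : edge G) (x : vert G) :
  contract_class e x \in [set contract_class e x | x : vert G].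
Proof. exact: imset_f. Qed.

Definition contract_proj (e : edge G) (x : vert G) : contract_vert e :=
  exist _ (contract_class e x) (contract_classP e x).

Definition contract (e : edge G) : graph :=
  @Graph (contract_vert e) {e' : edge G | e' != e}
    (fun e' => [set contract_proj e x | x in ends (val e')])
    (fun e' => ends_card_imset (contract_proj e) (ends_card (val e'))).

(* G + e with e = xy; the new edge is None. *)
Definition add_edge (x y : vert G) : graph :=
  @Graph (vert G) (option (edge G))
    (fun e => if e is Some e' then ends e' else [set x; y])
    (fun e => match e with
              | Some e' => ends_card e'
              | None => ends_card_set2 x y
              end).

(* Splitting v into v1 = Some v and v2 = None, joined by the new edge None;
   the edges at v that go to v2 are those selected by s. *)
Definition split_end (v : vert G) (s : pred (edge G)) (e : edge G)
    (x : vert G) : option (vert G) :=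
  if (x == v) && s e then None else Some x.

Definition split_graph (v : vert G) (s : pred (edge G)) : graph :=
  @Graph (option (vert G)) (option (edge G))
    (fun e => if e is Some e' then split_end v s e' @: ends e'
              else [set Some v; None])
    (fun e => match e with
              | Some e' => ends_card_imset (split_end v s e') (ends_card e')
              | None => ends_card_set2 (Some v) None
              end).

End Graphs.

Arguments nonadjacent : clear implicits.
Arguments add_edge : clear implicits.

Definition is_iso (G H : graph) (phi : vert G -> vert H)
    (psi : edge G -> edge H) : Prop :=
  [/\ bijective phi, bijective psi
    & forall e, ends (psi e) = phi @: ends e].

Definition iso (G H : graph) : Prop :=
  exists (phi : vert G -> vert H) (psi : edge G -> edge H), is_iso phi psi.

Inductive has_minor (H : graph) : graph -> Prop :=
| minor_iso (G : graph) : iso G H -> has_minor H G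
| minor_delete (G : graph) (e : edge G) :
    has_minor H (delete e) -> has_minor H G
| minor_contract (G : graph) (e : edge G) :
    has_minor H (contract e) -> has_minor H G.

Definition has_proper_minor (H G : graph) : Prop :=
  has_minor H G /\ ~ iso G H.

Definition deletable (H G : graph) (e : edge G) : Prop :=
  three_connected (delete e) /\ has_minor H (delete e).
Arguments deletable : clear implicits.

(* The wheel with k spokes (inl i) and k rim edges (inr i); the hub is None. *)
Definition wheel_ends (k : nat) (e : 'I_k + 'I_k) : {set option 'I_k} :=
  match e with
  | inl i => [set None; Some i]
  | inr i => [set Some i; Some (ordS i)]
  end.

Lemma wheel_ends_card (k : nat) (e : 'I_k + 'I_k) : 0 < #|wheel_ends e| <= 2.
Proof. by case: e => i; apply: ends_card_set2. Qed.

Definition wheel (k : nat) : graph :=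
  @Graph (option 'I_k) ('I_k + 'I_k)%type (@wheel_ends k) (@wheel_ends_card k).

(* G = K o f up to isomorphism.  The map psi records the names of the edges:
   f is psi None, and the edge e of K is psi (Some e) in G. *)
Definition vertex_split (K G : graph)
    (psi : option (edge K) -> edge G) : Prop :=
  exists (v : vert K) (s : pred (edge K)) (phi : option (vert K) -> vert G),
    [/\ 4 <= degree v,
        3 <= @degree (split_graph v s) (Some v),
        3 <= @degree (split_graph v s) None
      & @is_iso (split_graph v s) G phi psi].
Arguments vertex_split : clear implicits.

(* Main.v *)
Require Import Defs.
From mathcomp Require Import all_boot.
From Stdlib Require Import Classical_Prop.

Set Implicit Arguments.
Unset Strict Implicit.
Unset Printing Implicit Defensive.

(** The graph [G'] is obtained from [G] by contracting one edge [f = xy] and then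
    deleting edges as long as some edge is deletable. What carries the theorem
    is that [f] can be chosen such that [G/f] is simple, three-connected and has
    the minor [H] ([exists_contractible_triangle_free]).

    A minor is described by the map [p] that sends each vertex of [G] to the
    vertex of [H] whose branch set contains it ([minor_model], [model_minor]).
    As [H] has fewer vertices than [G] ([proper_minor_card]), some edge lies inside
    a branch set. The classical proof that a three-connected graph has an edge
    [xy] with [G/xy] three-connected, up to parallel edges, works inside the
    branch sets. If [x], [y], [z] is a cut for an edge [xy] inside a branch set,
    then [H], being three-connected, lives on one side of it, up to the classes
    of [x] and [z]. All vertices of another side [C] can be moved to the class
    of [z], and an edge from [z] to [C] is either as wanted or gives a cut with a
    part properly contained in [C] ([cut_part_contractible]).

    If the contractible edge [xy] obtained in this way lies in a triangle [xyw],
    then after the contraction the edges [xw] and [yw] are parallel, so neither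
    is used by the minor. As they are not deletable, [x] and [y] have degree 3
    ([triangle_degree3]). The third edge [xb] at [x] is contractible too, and [x]
    can be moved to the class of [b]. So either [xb] is in no triangle, or it is
    in the triangle [xbw] and [b] has degree 3, and so on: a fan with hub [w]
    grows until a contractible edge in no triangle is found, or the fan closes
    up and [G] is a wheel ([fan_contractible], [fan_cycle_wheel]).

    Let now [D] be the set of edges deleted from [G/f]. An edge [e] of [D] is not
    deletable in [G] although [(G-e)/f] contains a three-connected spanning
    subgraph with the minor [H]. So [G-e] has a vertex of degree 2, which is an
    end of [f], and [e] and [f] belong to a triad of [G] ([removed_edge_end]). The
    triad is the same for all [e] in [D], as otherwise the vertex of [G/f]
    obtained from [f] would lose two of its four edges
    ([removed_edges_incident]). So [D] has at most two elements, and these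
    numbers are the three cases of the theorem. *)

(** * Connected vertex sets *)

Lemma connect_ind (V : finType) (r : rel V) (P : V -> Prop) (x y : V) :
  P x -> (forall a b, P a -> r a b -> P b) -> connect r x y -> P y.
Proof.
move=> Px step /connectP[p rp ->]; elim: p x Px rp => //= z p IH x Px.
by case/andP=> rxz; apply: IH; apply: step rxz.
Qed.

Section Connectivity.
Variable V : finType.
Implicit Types (e : rel V) (A B C S : {set V}).

Definition within e A : rel V := [rel a b | [&& a \in A, b \in A & e a b]].

Definition conn e A : bool :=
  [forall a in A, forall b in A, connect (within e A) a b].

Lemma connect_within1 e A a b :
  a \in A -> b \in A -> e a b -> connect (within e A) a b.
Proof. by move=> aA bA ab; apply: connect1; rewrite /within /= aA bA. Qed.

Lemma connP e A :
  reflect {in A &, forall a b, connect (within e A) a b} (conn e A).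
Proof.
apply: (iffP forall_inP) => [cA a b aA bA | cA a aA].
  by move/forall_inP: (cA a aA) => /(_ b bA).
by apply/forall_inP => b bA; apply: cA.
Qed.

Lemma connect_within_sym e A : symmetric e -> connect_sym (within e A).
Proof.
by move=> se; apply: sym_connect_sym => a b; rewrite /within /= se andbCA.
Qed.

Lemma connect_withinS e A B x y :
  A \subset B -> connect (within e A) x y -> connect (within e B) x y.
Proof.
move=> /subsetP AB; apply: connect_sub => a b /and3P[aA bA ab].
by apply: connect_within1 => //; apply: AB.
Qed.

Lemma conn_from e A r : symmetric e ->
  {in A, forall a, connect (within e A) r a} -> conn e A.
Proof.
move=> se cr; apply/connP => a b aA bA.
by apply: connect_trans (cr b bA); rewrite connect_within_sym // cr.
Qed.

Lemma conn_ext e A B : A =i B -> conn e A -> conn e B.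
Proof. by move/setP->. Qed.

Lemma conn1 e x : conn e [set x].
Proof. by apply/connP => a b /set1P-> /set1P->; apply: connect0. Qed.

Lemma conn_refine e e' A :
  (forall a b, a \in A -> b \in A -> e a b -> connect (within e' A) a b) ->
  conn e A -> conn e' A.
Proof.
move=> ee' /connP cA; apply/connP => a b aA bA.
by apply: connect_sub (cA a b aA bA) => c d /and3P[cA' dA' cd]; apply: ee'.
Qed.

Lemma conn_mono e e' A :
  {in A &, subrel e e'} -> conn e A -> conn e' A.
Proof.
move=> ee'; apply: conn_refine => a b aA bA ab.
by apply: connect_within1 => //; apply: ee'.
Qed.

Lemma conn_exit e A C a b :
    conn e A -> a \in A -> a \in C -> b \in A -> b \notin C ->
  exists c d, [/\ c \in A, c \in C, d \in A, d \notin C & e c d].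
Proof.
move=> /connP cA aA aC bA bC.
case: (pickP (fun u : V * V => [&& u.1 \in A, u.1 \in C, u.2 \in A,
   u.2 \notin C & e u.1 u.2])) => [[c d] /and5P[]|none]; first by exists c, d.
suff: b \in C by rewrite (negPf bC).
apply: (connect_ind (P := fun v => v \in C)) (cA a b aA bA) => // c d cC.
case/and3P=> cA' dA cd; apply: contraT => dC.
by have := none (c, d); rewrite /= cA' cC dA dC cd.
Qed.

(** A walk that leaves [B] does so at a vertex of [X] and comes back at a
    vertex of [X], so each of its excursions can be replaced by a walk in [B]
    between these two. *)
Lemma conn_part e A B (X : pred V) :
    conn e A -> B \subset A ->
    (forall b a, b \in B -> a \in A -> a \notin B -> e b a -> X b) ->
    (forall a b, a \in A -> a \notin B -> b \in B -> e a b -> X b) ->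
    {in B &, forall x y, X x -> X y -> connect (within e B) x y} ->
  conn e B.
Proof.
move=> /connP cA /subsetP BA out inn cX; apply/connP => a b aB bB.
pose P v := if v \in B then is_true (connect (within e B) a v)
            else exists2 x, x \in B /\ X x & connect (within e B) a x.
suff: P b by rewrite /P bB.
apply: connect_ind (cA a b (BA a aB) (BA b bB)) => [|c d].
  by rewrite /P aB connect0.
rewrite /P => Pc /and3P[cA' dA cd].
case: ifP Pc => cB Pc; case: ifP => dB.
- by apply: connect_trans Pc (connect_within1 _ _ _).
- by exists c => //; split=> //; apply: out cd => //; rewrite dB.
- case: Pc => x [xB Xx] ax; apply: connect_trans ax (cX _ _ _ _ _ _) => //.
  by apply: inn cd => //; rewrite cB.
- by [].
Qed.

Lemma conn_part_clique e A B (X : pred V) : symmetric e ->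
    conn e A -> B \subset A ->
    (forall b a, b \in B -> a \in A -> a \notin B -> e b a -> X b) ->
    {in B &, forall x y, X x -> X y -> x != y -> e x y} ->
  conn e B.
Proof.
move=> se cA BA out clq; apply: (conn_part (X := X)) cA _ _ _ _ => //.
- by move=> a b aA aB bB ab; apply: (out b a) => //; rewrite se.
- move=> x y xB yB Xx Xy; have [->|xy] := eqVneq x y; first exact: connect0.
  by apply: connect_within1 => //; apply: clq.
Qed.

Lemma conn_setU e A B z : symmetric e ->
  conn e A -> conn e B -> z \in A -> z \in B -> conn e (A :|: B).
Proof.
move=> se /connP cA /connP cB zA zB; apply: (conn_from (r := z)) => // a.
case/setUP=> aI; first by apply: connect_withinS (cA z a zA aI); apply: subsetUl.
by apply: connect_withinS (cB z a zB aI); apply: subsetUr.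
Qed.

Lemma conn_setU1 e A x y : symmetric e ->
  conn e A -> y \in A -> e x y -> conn e (x |: A).
Proof.
move=> se /connP cA yA xy; apply: (conn_from (r := y)) => // a.
case/setU1P=> [->|aA]; last first.
  by apply: connect_withinS (cA y a yA aA); apply: subsetUr.
by apply: connect_within1; rewrite ?inE ?yA ?eqxx ?orbT // se.
Qed.

Definition three_conn e : Prop :=
  4 <= #|V| /\ forall S, #|S| <= 2 -> conn e (~: S).

Definition nbrs e x : {set V} := [set y | e x y].

Lemma exists_outside S : #|S| < #|V| -> exists v, v \notin S.
Proof.
move=> ltS; have: 0 < #|~: S| by rewrite cardsCs setCK subn_gt0.
by case/card_gt0P=> v; rewrite inE; exists v.
Qed.

Lemma card_set2 (x y : V) : #|[set x; y]| <= 2.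
Proof. by rewrite cards2; case: (x == y). Qed.

Lemma card_set3 (x y z : V) : #|[set x; y; z]| <= 3.
Proof. by rewrite setUC cardsU1 cards2; case: (_ \in _); case: (_ == _). Qed.

Lemma conn_remove1 e x : three_conn e -> conn e (~: [set x]).
Proof. by case=> _; apply; rewrite cards1. Qed.

Lemma conn_remove2 e x y : three_conn e -> conn e (~: [set x; y]).
Proof. by case=> _; apply; apply: card_set2. Qed.

Lemma three_conn_nbrs e x : irreflexive e -> three_conn e -> 3 <= #|nbrs e x|.
Proof.
move=> irr [V4 k]; rewrite leqNgt; apply/negP => lt3.
have [|v] := @exists_outside (x |: nbrs e x).
  apply: leq_trans V4; rewrite cardsU1 -[4]/(1 + 3) -addnS leq_add //.
  by case: (_ \notin _).
rewrite !inE negb_or => /andP[vx nxv].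
have [||||c [d [_ /set1P-> dS _ xd]]] :=
  @conn_exit e (~: nbrs e x) [set x] x v (k _ lt3).
- by rewrite !inE irr.
- by rewrite inE.
- by rewrite !inE.
- by rewrite inE.
- by rewrite !inE xd in dS.
Qed.

End Connectivity.

(** * Minor models *)

Section Models.
Variables V W : finType.
Implicit Types (e : rel V) (eH : rel W) (p : V -> W).

(** The classes of [p] are the branch sets of a minor; they cover [V], since
    minors are formed here without deleting vertices. *)
Definition model eH e p : Prop :=
  [/\ forall u, exists x, p x = u,
      forall u, conn e [set x | p x == u]
    & forall u v, eH u v -> exists x y, [/\ p x = u, p y = v & e x y]].

Lemma model_preim_conn eH e p B : symmetric e ->
  model eH e p -> conn eH B -> conn e (p @^-1: B).
Proof.
move=> se [_ pc pe] /connP cB; apply/connP => a b; rewrite !inE => aB bB.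
pose P u := u \in B /\ forall v, p v = u -> connect (within e (p @^-1: B)) a v.
have fib u v w : u \in B -> p v = u -> p w = u ->
    connect (within e (p @^-1: B)) v w.
  move=> uB pv pw; have /connP/(_ v w) := pc u; rewrite !inE pv pw eqxx.
  move=> /(_ isT isT); apply: connect_withinS; apply/subsetP => t.
  by rewrite !inE => /eqP->.
suff [_ /(_ b erefl)]: P (p b) by [].
apply: connect_ind (cB _ _ aB bB) => [|u v [uB au] /and3P[_ vB uv]].
  by split=> // v pv; apply: (fib (p a)).
split=> // w pw; have [x [y [px py xy]]] := pe u v uv.
apply: connect_trans (au x px) (connect_trans _ (fib v y w vB py pw)).
by apply: connect_within1 => //; rewrite inE ?px ?py.
Qed.

Lemma model_card eH e p : model eH e p -> #|W| <= #|V|.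
Proof.
case=> surj _ _; rewrite -cardsT -(cardsT V).
suff ->: [set: W] = p @: [set: V] by apply: leq_imset_card.
apply/esym/eqP; rewrite eqEsubset subsetT /=; apply/subsetP => u _.
by have [x <-] := surj u; apply: imset_f.
Qed.

Lemma model_mono eH e e' p : subrel e e' -> model eH e p -> model eH e' p.
Proof.
move=> ee' [surj pc pe]; split=> // [u | u v uv].
  by apply: conn_mono (pc u) => a b _ _; apply: ee'.
by have [x [y [px py xy]]] := pe u v uv; exists x, y; split=> //; apply: ee'.
Qed.

(** When no branch set has two vertices, the minor is a spanning subgraph, and
    three-connectedness passes from a spanning subgraph to the graph. *)
Lemma model_inj_3conn eH e p : symmetric e -> injective p ->
  model eH e p -> three_conn eH -> three_conn e.
Proof.
move=> se pI mp [W4 k]; split=> [|S S2]; first exact: leq_trans (model_card mp).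
have cS : conn eH (~: (p @: S)) by apply: k; rewrite card_imset.
apply: conn_ext (model_preim_conn se mp cS) => v.
by rewrite !inE mem_imset.
Qed.

Definition recolour p (C : {set V}) k : V -> W :=
  fun v => if v \in C then k else p v.

Lemma recolour_in p (C : {set V}) k v : v \in C -> recolour p C k v = k.
Proof. by rewrite /recolour => ->. Qed.

Lemma recolour_out p (C : {set V}) k v : v \notin C -> recolour p C k v = p v.
Proof. by rewrite /recolour => /negPf->. Qed.

Lemma model_recolour eH e p (C : {set V}) z : symmetric e ->
    z \notin C -> conn e (z |: C) ->
    (forall u, exists2 x, x \notin C & p x = u) ->
    (forall u, conn e ([set x | p x == u] :\: C)) ->
    (forall u v, eH u v -> exists x y,
       [/\ recolour p C (p z) x = u, recolour p C (p z) y = v & e x y]) ->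
  model eH e (recolour p C (p z)).
Proof.
move=> se zC czC surj pc pe; split=> // u.
  by have [x xC <-] := surj u; exists x; rewrite recolour_out.
have [->|uz] := eqVneq u (p z).
  have zI: z \in [set x | p x == p z] :\: C by rewrite !inE zC eqxx.
  apply: conn_ext (conn_setU se (pc (p z)) czC zI (setU11 _ _)) => v.
  rewrite !inE /recolour; case: ifP => vC /=; first by rewrite orbT eqxx.
  by case: (v =P z) => [->|_]; rewrite ?eqxx ?orbT ?orbF.
apply: conn_ext (pc u) => v; rewrite !inE /recolour; case: ifP => //= vC.
by rewrite eq_sym (negPf uz).
Qed.

End Models.

Lemma model_comp (V W T : finType) (eT : rel T) (eW : rel W) (eV : rel V)
    (p : W -> T) (q : V -> W) : symmetric eV ->
  model eT eW p -> model eW eV q -> model eT eV (p \o q).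
Proof.
move=> se [ps pc pe] mq; have [qs _ qe] := mq; split.
- by move=> u; have [w <-] := ps u; have [v <-] := qs w; exists v.
- move=> u; apply: conn_ext (model_preim_conn se mq (pc u)) => v.
  by rewrite !inE.
- move=> u v uv; have [a [b [<- <- ab]]] := pe u v uv.
  by have [x [y [<- <- xy]]] := qe a b ab; exists x, y.
Qed.

(** * Contractible edges inside a branch set *)

Section Contractible.
Variables V W : finType.
Variables (e : rel V) (eH : rel W).
Hypotheses (e_sym : symmetric e) (e_irr : irreflexive e) (e_3conn : three_conn e).
Hypotheses (eH_sym : symmetric eH) (eH_irr : irreflexive eH).
Hypothesis eH_3conn : three_conn eH.

(** For an edge [xy] of a three-connected graph on at least five vertices, this
    says that contracting [xy] and removing parallel edges gives a
    three-connected graph. *)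
Definition contractible x y := [forall z, conn e (~: [set x; y; z])].

Lemma contractible_sym x y : contractible x y -> contractible y x.
Proof.
move=> /forallP cxy; apply/forallP => z; apply: conn_ext (cxy z) => v.
by rewrite !inE [(v == x) || _]orbC.
Qed.

(** [C] is a union of components of [V - {x, y, z}]. *)
Definition cut_part x y z (C : {set V}) : Prop :=
  [/\ x \notin C, y \notin C, z \notin C
    & forall c v, c \in C -> v \notin C -> e c v -> v \in [set x; y; z]].

Lemma cut_part_nbr (x y z : V) (C : {set V}) : cut_part x y z C ->
  C != set0 -> x != y -> x != z -> exists2 c, c \in C & e x c.
Proof.
move=> [xC yC zC cl] /set0Pn[c0 c0C] xy xz.
have neC u v : u \in C -> v \notin C -> u != v.
  by move=> uC; apply: contraNneq => <-.
have [||c [d [_ cC dS dC cd]]] :=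
  @conn_exit V e _ C c0 x (conn_remove2 y z e_3conn) _ c0C _ xC.
- by rewrite !inE negb_or !neC.
- by rewrite !inE negb_or xy.
exists c => //; rewrite e_sym.
by have := cl c d cC dC cd; move: dS; rewrite !inE -orbA;
  case/norP=> /negPf-> /negPf->; rewrite !orbF => /eqP <-.
Qed.

(** In the presence of the edge [xy], a small part [C] matters to the minor only
    through the adjacency of the classes of [x] and of [z]. Hence all of [C] may
    be given to [z]: the class of [x] stays connected because it can pass
    through [xy] instead of [C], and [x] has a neighbour in [C]. *)
Lemma recolour_cut_part p x y z C : model eH e p ->
    e x y -> p x = p y -> x != z -> y != z -> cut_part x y z C -> C != set0 ->
    (forall c, c \in C -> p c = p x \/ p c = p z) ->
  exists2 p', model eH e p' & forall c, c \in C -> p' c = p' z.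
Proof.
move=> mp xy pxy xz yz cC C0 pC.
have [xC yC zC cl] := cC; have [surj pc pe] := mp.
have [pxz|pxz] := eqVneq (p x) (p z).
  by exists p => // c /pC; rewrite pxz; case.
have xny : x != y by apply: contraTneq xy => ->; rewrite e_irr.
have [c cCC xc] := cut_part_nbr cC C0 xny xz.
pose p' := recolour p C (p z).
have edge_hk u v : u \in [:: p x; p z] -> v \in [:: p x; p z] -> eH u v ->
    exists a b, [/\ p' a = u, p' b = v & e a b].
  have [xC1 cC1] : p' x = p x /\ p' c = p z.
    by split; [apply: recolour_out | apply: recolour_in].
  rewrite !inE => /orP[]/eqP-> /orP[]/eqP->; rewrite ?eH_irr // => _.
    by exists x, c.
  by exists c, x; split=> //; rewrite e_sym.
have pC1 a : a \in C -> p a \in [:: p x; p z].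
  by move=> /pC; rewrite !inE => -[]->; rewrite eqxx ?orbT.
have pC2 a b : a \in C -> e a b -> p b \in [:: p x; p z].
  move=> aC ab; case bC: (b \in C); first exact: pC1.
  have := cl a b aC (negbT bC) ab; rewrite !inE -orbA.
  by case/or3P=> /eqP->; rewrite -?pxy eqxx ?orbT.
exists p'; last by move=> v vC; rewrite /p' (recolour_in _ _ vC) recolour_out.
apply: model_recolour => //.
- apply: (conn_part_clique (X := pred1 z)) (conn_remove2 x y e_3conn) _ _ _ => //.
  + apply/subsetP => v; rewrite !inE negb_or => /predU1P[->|vC].
      by rewrite eq_sym xz eq_sym yz.
    by rewrite !(contraTneq _ vC) // => ->.
  + move=> v a; rewrite !inE negb_or => /predU1P[->//|vC] /andP[ax ay].
    rewrite negb_or => /andP[az aC] va; have := cl v a vC aC va.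
    by rewrite !inE (negPf ax) (negPf ay) (negPf az).
  + by move=> a b _ _ /= /eqP-> /eqP->; rewrite eqxx.
- move=> u; have [v <-] := surj u; case vC: (v \in C).
    by have [->|->] := pC v vC; [exists x | exists z].
  by exists v; rewrite ?vC.
- move=> u; apply: (conn_part_clique (X := mem [set x; y; z])) (pc u) _ _ _ => //.
  + exact: subsetDl.
  + move=> b a; rewrite [_ \in _ :\: _]in_setD => /andP[bC bu] au.
    rewrite in_setD au andbT negbK e_sym => aC ba.
    exact: cl ba.
  + move=> a b; rewrite !inE => /andP[_ /eqP au] /andP[_ /eqP bu].
    have nxz : p x == p z = false by apply/eqP/eqP.
    have nyz : p y == p z = false by rewrite -pxy.
    by move=> /orP[/orP[]|] /eqP aE /orP[/orP[]|] /eqP bE;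
       move: au bu nxz nyz; rewrite aE bE ?eqxx // => -> ->;
       rewrite ?eqxx // e_sym.
- move=> u v uv; have [a [b [pa pb ab]]] := pe u v uv.
  case aC: (a \in C).
    by apply: edge_hk => //; rewrite -?pa -?pb; [apply: pC1 | apply: pC2 ab].
  case bC: (b \in C).
    apply: edge_hk => //; rewrite -?pa -?pb; last exact: pC1.
    by apply: (@pC2 b) => //; rewrite e_sym.
  by exists a, b; rewrite /p' !recolour_out ?aC ?bC.
Qed.
Definition contractible_in_model p x y :=
  [/\ model eH e p, e x y, p x = p y & contractible x y].

Lemma contractible_in_model_sym p x y :
  contractible_in_model p x y -> contractible_in_model p y x.
Proof.
case=> mp xy pxy /contractible_sym cyx.
by split; [exact: mp | rewrite e_sym | rewrite pxy | exact: cyx].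
Qed.

Lemma far_side_cut_part x y z r : r \notin [set x; y; z] ->
  cut_part x y z [set v | (v \notin [set x; y; z]) &&
    ~~ connect (within e (~: [set x; y; z])) r v].
Proof.
move=> rS; split; try by rewrite !inE eqxx ?orbT.
move: rS; set S := [set x; y; z] => rS.
move=> c v; rewrite 2!in_set negb_and !negbK => /andP[cS rc].
case/orP=> // rv cv; apply: contraT => vS.
case/negP: rc; apply: connect_trans rv _; apply: connect_within1.
- by rewrite in_setC.
- by rewrite in_setC.
- by rewrite e_sym.
Qed.

(** This is the argument by which a three-connected graph has a contractible
    edge, run inside the branch sets: once [C] belongs to the class of [z], an
    edge from [z] to some [c] of [C] lies in a branch set, and if it is not
    contractible, then the cut [z], [c], [u] that shows it separates [x] and [y]
    from a proper part of [C]. *)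
Lemma cut_part_contractible p x y z C : model eH e p ->
    e x y -> p x = p y -> x != z -> y != z -> cut_part x y z C -> C != set0 ->
    (forall c, c \in C -> p c = p x \/ p c = p z) ->
  exists p' a b, contractible_in_model p' a b.
Proof.
have [n] := ubnP #|C|; elim: n => // n IH in p x y z C *.
rewrite ltnS => leCn mp xy pxy xz yz cC C0 pC.
have [xC yC zC cl] := cC.
have [p1 mp1 p1C] := recolour_cut_part mp xy pxy xz yz cC C0 pC.
have [c cCC zc] : exists2 c, c \in C & e z c.
  have cC' : cut_part z x y C.
    by split=> // a v aC vC av; rewrite -setUA setUC; apply: cl av.
  by apply: cut_part_nbr cC' C0 _ _; rewrite eq_sym.
have nC v : v \notin C -> v != c by apply: contraNneq => ->.
have [|/forallPn[u nconn]] := boolP (contractible z c).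
  by exists p1, z, c; split=> //; rewrite p1C.
have zu : z != u.
  apply: contraNneq nconn => <-; apply: conn_ext (conn_remove2 z c e_3conn) => v.
  by rewrite !inE; case: (v == z); rewrite ?orbF.
have cu : c != u.
  apply: contraNneq nconn => <-; apply: conn_ext (conn_remove2 z c e_3conn) => v.
  by rewrite !inE; case: (v == c); rewrite ?orbF ?orbT.
(* This set is connected, because a walk that avoids [z] and [u] enters and
   leaves [C] at [x] or [y], which are adjacent. *)
pose D := ~: (C :|: [set z; u]).
have DI v : (v \in D) = [&& v \notin C, v != z & v != u] by rewrite !inE !negb_or.
have cD : conn e D.
  apply: (conn_part_clique (X := mem [set x; y]))
    (conn_remove2 z u e_3conn) _ _ _ => //.
  - by apply/subsetP => v; rewrite DI !inE negb_or => /and3P[_ -> ->].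
  - move=> v a; rewrite !DI !inE !negb_or => /and3P[vC vz vu] /andP[az au].
    rewrite az au !andbT negbK => aC va.
    have : v \in [set x; y; z] by apply: cl aC vC _; rewrite e_sym.
    by rewrite !inE (negPf vz) orbF.
  - move=> a b _ _; rewrite /= !inE => /orP[]/eqP-> /orP[]/eqP->;
    by rewrite ?eqxx // e_sym.
have [r rD] : exists r, r \in D.
  have [xu|xu] := eqVneq x u; last by exists x; rewrite DI xC xz xu.
  by exists y; rewrite DI yC yz -xu; apply: contraTneq xy => ->; rewrite e_irr.
have DS v : v \in D -> v \notin [set z; c; u].
  by rewrite DI !inE !negb_or => /and3P[vC -> ->]; rewrite nC.
have := far_side_cut_part (DS r rD); set C' := [set v | _] => cC'.
have C'C : C' \subset C :\ c.
  apply/subsetP => v; rewrite in_set => /andP[].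
  rewrite !inE !negb_or => /andP[/andP[vz vc] vu] rv; rewrite vc.
  apply: contraNT rv => vC.
  have vD : v \in D by rewrite DI vC vz vu.
  apply: connect_withinS (connP _ _ cD r v rD vD).
  by apply/subsetP => w /DS; rewrite in_setC.
apply: (IH p1 z c u C') => //.
- apply: leq_ltn_trans (subset_leq_card C'C) _.
  by move: leCn; rewrite (cardsD1 c C) cCC.
- by rewrite p1C.
- apply: contraNneq nconn => C'0; apply: (conn_from (r := r)) => // v.
  rewrite in_setC => vS; apply: contraT => rv.
  by have := in_set0 v; rewrite -C'0 inE vS rv.
- by move=> v /(subsetP C'C); rewrite inE => /andP[_ /p1C]; left.
Qed.

Lemma exists_contractible p : model eH e p -> #|W| < #|V| ->
  exists p' a b, contractible_in_model p' a b.
Proof.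
move=> mp ltWV; have [surj pc _] := mp.
have [x [y [xy pxy]]] : exists x y, e x y /\ p x = p y.
  have [pI|] := boolP (injectiveb p).
    by have := leq_card _ (injectiveP _ pI); rewrite leqNgt ltWV.
  case/injectivePn=> a [b ab pab].
  have [||||c [d [cA _ dA _ cd]]] := @conn_exit V e _ [set a] a b (pc (p a)).
  - by rewrite inE.
  - by rewrite inE.
  - by rewrite inE pab.
  - by rewrite inE eq_sym.
  by exists c, d; split=> //; move: cA dA; rewrite !inE => /eqP-> /eqP->.
have [|/forallPn[z nconn]] := boolP (contractible x y).
  by exists p, x, y.
have xz : x != z.
  apply: contraNneq nconn => <-; apply: conn_ext (conn_remove2 x y e_3conn) => v.
  by rewrite !inE; case: (v == x); rewrite ?orbF.
have yz : y != z.
  apply: contraNneq nconn => <-; apply: conn_ext (conn_remove2 x y e_3conn) => v.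
  by rewrite !inE; case: (v == y); rewrite ?orbF ?orbT.
(* The other classes avoid the cut and are together connected, because [H] is
   connected without two of its vertices. *)
pose B := ~: [set p x; p z].
have cB : conn e (p @^-1: B) :=
  model_preim_conn e_sym mp (conn_remove2 _ _ eH_3conn).
have [|h hB] := @exists_outside W [set p x; p z].
  by apply: leq_ltn_trans (card_set2 _ _) _; case: eH_3conn => /ltnW.
have [r pr] := surj h.
have BS v : v \in p @^-1: B -> v \notin [set x; y; z].
  rewrite !inE; apply: contra; rewrite -orbA.
  by case/or3P=> /eqP->; rewrite -?pxy eqxx ?orbT.
have rB : r \in p @^-1: B by rewrite inE pr in_setC.
apply: cut_part_contractible mp xy pxy xz yz (far_side_cut_part (BS r rB)) _ _.
  apply: contraNneq nconn => C0; apply: (conn_from (r := r)) => // v.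
  rewrite in_setC => vS; apply: contraT => rv.
  by have := in_set0 v; rewrite -C0 inE vS rv.
move=> c; rewrite inE => /andP[_ rc].
have: c \notin p @^-1: B.
  apply: contra rc => cB'; apply: connect_withinS (connP _ _ cB r c rB cB').
  by apply/subsetP => w /BS; rewrite in_setC.
by rewrite !inE negbK => /orP[]/eqP->; [left|right].
Qed.

End Contractible.

(** * Deleting an edge *)

Section Deletion.
Variable V : finType.
Implicit Types (e : rel V) (S : {set V}).

Lemma set2_eqP (a b x y : V) :
  reflect ((a = x /\ b = y) \/ (a = y /\ b = x)) ([set a; b] == [set x; y]).
Proof.
apply: (iffP eqP) => [E|[[-> ->]|[-> ->]] //]; last by rewrite setUC.
have: a \in [set x; y] by rewrite -E set21.
have: b \in [set x; y] by rewrite -E set22.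
have: x \in [set a; b] by rewrite E set21.
have: y \in [set a; b] by rewrite E set22.
rewrite !inE => /orP[]/eqP yE /orP[]/eqP xE /orP[]/eqP bE /orP[]/eqP aE;
  by move: yE xE bE aE; do 4 ?[move=> ?; subst]; auto.
Qed.

Lemma set2_of_mem (x : V) S : x \in S -> #|S| <= 2 -> exists z, S = [set x; z].
Proof.
move=> xS; rewrite (cardsD1 x) xS ltnS => /card_le1_eqP S1.
have [z zS|S0] := pickP (mem (S :\ x)).
  exists z; apply/setP => v; rewrite !inE.
  have [->|vx] //= := eqVneq v x; have [->|vz] := eqVneq v z.
    by move: zS; rewrite !inE => /andP[].
  apply: contraNF vz => vS; apply/eqP; apply: S1 => //.
  by rewrite !inE vx.
exists x; apply/setP => v; rewrite !inE orbb; have [->|vx] //= := eqVneq v x.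
by have := S0 v; rewrite !inE vx.
Qed.

Definition del e x w : rel V := [rel a b | e a b && ([set a; b] != [set x; w])].

Lemma del_sym e x w : symmetric e -> symmetric (del e x w).
Proof. by move=> se a b; rewrite /del /= se setUC. Qed.

Lemma delE e x w a b : e a b ->
  del e x w a b \/ (a = x /\ b = w) \/ (a = w /\ b = x).
Proof.
by move=> ab; rewrite /del /= ab; case: set2_eqP => H; [right | left].
Qed.

(** A set of at most two vertices that contains both or neither of [x] and [y] is
    harmless because it is one in the graph with [xy] contracted. If it contains
    only [x], then adding [y] to it leaves a connected graph, and [y] has a third
    neighbour, which is in that graph. *)
Lemma uncontract_3conn e x y : symmetric e -> irreflexive e -> e x y ->
    4 <= #|V| -> 3 <= #|nbrs e x| -> 3 <= #|nbrs e y| ->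
    (forall z, conn e (~: [set x; y; z])) ->
    (forall S, #|S| <= 2 -> x \notin S -> y \notin S -> conn e (~: S)) ->
  three_conn e.
Proof.
move=> se irr xy V4 dx dy c3 c0; split=> // S S2.
have half a b : e a b -> 3 <= #|nbrs e b| ->
    (forall z, conn e (~: [set a; b; z])) -> a \in S -> conn e (~: S).
  move=> ab db cz /set2_of_mem/(_ S2)[z ->].
  have [<-|bz] := eqVneq b z.
    by apply: conn_ext (cz a) => v; rewrite !inE; case: (v == a); rewrite ?orbF.
  have [c bc cS] : exists2 c, e b c & c \notin [set a; z].
    have /subsetPn[c] : ~~ (nbrs e b \subset [set a; z]).
      apply: contraL db => /subset_leq_card; rewrite -leqNgt => le.
      exact: leq_trans le (card_set2 _ _).
    by rewrite inE => bc cS; exists c.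
  have nca : b != a by apply: contraTneq ab => ->; rewrite irr.
  have cB : c \in ~: [set a; b; z].
    move: cS; rewrite !inE !negb_or => /andP[-> ->]; rewrite andbT /=.
    by apply: contraTneq bc => ->; rewrite irr.
  apply: conn_ext (conn_setU1 se (cz z) cB bc) => v; rewrite !inE.
  by have [->|] := eqVneq v b; rewrite ?orbF //= (negPf nca) (negPf bz).
have [xS|xS] := boolP (x \in S); first exact: half xy dy c3 xS.
have [yS|yS] := boolP (y \in S); last exact: c0.
apply: (half y x) yS => [|//|z]; first by rewrite se.
by apply: conn_ext (c3 z) => v; rewrite !inE [(v == x) || _]orbC.
Qed.

End Deletion.

(** * Fans and wheels *)

Section Fans.
Variables V W : finType.
Variables (e : rel V) (eH : rel W).
Hypotheses (e_sym : symmetric e) (e_irr : irreflexive e) (e_3conn : three_conn e).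
Hypothesis V5 : 5 <= #|V|.
Hypotheses (eH_sym : symmetric eH) (eH_irr : irreflexive eH).

Hypothesis nodel : forall x w p,
  e x w -> model eH (del e x w) p -> ~ three_conn (del e x w).

Let neq x y : e x y -> x != y.
Proof. by apply: contraTneq => ->; rewrite e_irr. Qed.

(** In a triangle [xyw] with [xy] contractible, the edge [xw] is parallel to [yw]
    after the contraction of [xy], so the minor does not use it; being undeletable,
    it must end at a vertex of degree 3. *)
Lemma triangle_degree3 p x y w : contractible_in_model e eH p x y ->
  e x w -> e y w -> #|nbrs e x| = 3.
Proof.
move=> [mp xy pxy cxy] xw yw.
apply/eqP; rewrite eqn_leq three_conn_nbrs // andbT leqNgt; apply/negP => dx.
pose d := del e x w.
have ds : symmetric d by apply: del_sym.
have ywx : del e x w y w.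
  rewrite /del /= yw; apply/set2_eqP => -[[yx _]|[yw' _]].
    by move: xy; rewrite yx e_irr.
  by move: yw; rewrite yw' e_irr.
have xyd : d x y.
  rewrite /d /del /= xy; apply/set2_eqP => -[[_ yw']|[xw' _]].
    by move: yw; rewrite yw' e_irr.
  by move: xw; rewrite xw' e_irr.
have detour (A : {set V}) : x \in A -> y \in A -> w \in A -> connect (within d A) x w.
  move=> xA yA wA; apply: (@connect_trans _ _ y);
  exact: connect_within1.
have detourS (A : {set V}) : x \in A -> y \in A -> w \in A -> conn e A -> conn d A.
  move=> xA yA wA; apply: conn_refine => a b aA bA /(delE x w)[ab|].
    exact: connect_within1.
  case=> -[-> ->]; first exact: detour.
  by rewrite connect_within_sym // detour.
have avoid (A : {set V}) : x \notin A \/ w \notin A -> conn e A -> conn d A.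
  move=> nA; apply: conn_mono => a b aA bA /(delE x w)[] //.
  by case=> -[ax bw]; move: aA bA; rewrite ax bw; case: nA => /negPf->.
have [surj pc pe] := mp.
apply: (@nodel x w p) => //.
  split=> // [u | u v uv].
    have [pxu|pxu] := eqVneq (p x) u; last first.
      by apply: avoid (pc u); left; rewrite inE.
    have [pwu|pwu] := eqVneq (p w) u; last first.
      by apply: avoid (pc u); right; rewrite inE.
    by apply: detourS (pc u); rewrite inE ?pwu -?pxy ?pxu.
  have [a [b [pa pb /(delE x w)[ab|]]]] := pe u v uv; first by exists a, b.
  case=> -[ax bw].
    by exists y, w; rewrite -pa -pb ax bw pxy.
  by exists w, y; split; rewrite -?pa -?pb ?ax ?bw ?pxy // [del _ _ _ _ _]ds.
have [V4 k] := e_3conn.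
apply: (@uncontract_3conn _ _ x y) => //.
- by move=> a; rewrite /d /del /= e_irr.
- have: nbrs e x :\ w \subset nbrs d x.
    apply/subsetP => a; rewrite !inE => /andP[aw /(delE x w)[] //].
    case=> -[xx aE]; move: aw; rewrite aE ?eqxx //.
    by rewrite -{1}xx ?eqxx // => _; rewrite -xx.
  by move/subset_leq_card; apply: leq_trans; move: dx; rewrite (cardsD1 w) inE xw.
- have <- : nbrs e y = nbrs d y; last exact: three_conn_nbrs.
  apply/setP => a; rewrite !inE /d /del /=.
  case: set2_eqP => [[[yx _]|[yw' _]]|]; rewrite ?andbT //.
    by move: xy; rewrite yx e_irr.
  by move: yw; rewrite yw' e_irr.
- by move=> z; apply: avoid (forallP cxy z); left; rewrite !inE eqxx.
- move=> S S2 xS yS; have [wS|wS] := boolP (w \in S).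
    by apply: avoid (k S S2); right; rewrite inE negbK.
  by apply: detourS (k S S2); rewrite inE.
Qed.

Lemma degree3_third_nbr x y w : #|nbrs e x| = 3 -> e x y -> e x w -> y != w ->
  exists b, [/\ b != y, b != w & nbrs e x = [set w; y; b]].
Proof.
move=> d3 xy xw yw; have := d3.
rewrite (cardsD1 w) inE xw (cardsD1 y) !inE yw xy => /eqP.
rewrite !eqSS => /cards1P[b bE]; exists b.
have := set11 b; rewrite -bE !inE => /and3P[b1 b2 _]; split=> //.
apply/setP => v; have := congr1 (fun A : {set V} => v \in A) bE; rewrite !inE.
have [->|vw] := eqVneq v w; first by rewrite xw.
by have [->|vy] := eqVneq v y; first by rewrite xy.
Qed.

(** A vertex of degree 3 that ends the edge [xb] and lies in a triangle [xyw] is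
    attached to the rest of the graph by the edge [yw] only, so removing it with
    [b] and one more vertex cuts no more than removing these two. *)
Lemma third_edge_contractible x y w b : nbrs e x = [set w; y; b] -> e y w ->
  contractible e x b.
Proof.
move=> nx yw; apply/forallP => z.
apply: (conn_part_clique (X := mem [set w; y]))
  (conn_remove2 b z e_3conn) _ _ _ => //.
- by apply/subsetP => v; rewrite !inE !negb_or -andbA => /and3P[_ -> ->].
- move=> v a; rewrite !in_setC negbK !in_setU !in_set1 !negb_or -andbA.
  case/and3P=> vx vb vz /andP[ab az]; rewrite (negPf ab) (negPf az) !orbF.
  move/eqP->; rewrite e_sym => xv.
  have : v \in nbrs e x by rewrite inE.
  by rewrite nx !inE (negPf vb) orbF.
- move=> a c _ _; rewrite /= !inE => /orP[]/eqP-> /orP[]/eqP->;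
  by rewrite ?eqxx // e_sym.
Qed.

(** Otherwise [b] and [w] would separate [x] and [y] from a fifth vertex. *)
Lemma third_nbr_not_shared x y w b : nbrs e x = [set w; y; b] ->
  b != y -> b != w -> e y w -> #|nbrs e y| = 3 -> ~~ e y b.
Proof.
move=> nx by_ bw yw dy; apply/negP => yb.
have nE v : e x v = (v \in [set w; y; b]) by rewrite -nx inE.
have [xw xy xb] : [/\ e x w, e x y & e x b] by rewrite !nE !inE !eqxx !orbT.
have ny : nbrs e y = [set w; x; b].
  apply/esym/eqP; rewrite eqEcard dy; apply/andP; split; last first.
    rewrite setUC cardsU1 cards2 !inE negb_or bw.
    by rewrite [b == x]eq_sym (neq xb) [w == x]eq_sym (neq xw).
  by apply/subsetP => v; rewrite !inE -orbA => /or3P[]/eqP-> //; rewrite e_sym.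
have [|v] := @exists_outside V [set w; b; x; y].
  apply: leq_trans V5; rewrite ltnS setUC cardsU1 -[4]/(1 + 3).
  by apply: leq_add (card_set3 _ _ _); case: (_ \notin _).
rewrite !inE !negb_or -!andbA => /and4P[vw vb vx vy].
have [||||c [d [_ cC dA dC cd]]] :=
  @conn_exit V e _ [set x; y] x v (conn_remove2 w b e_3conn).
- by rewrite !inE negb_or (neq xw) (neq xb).
- by rewrite !inE eqxx.
- by rewrite !inE negb_or vw.
- by rewrite !inE negb_or vx.
move: dA dC; rewrite !inE !negb_or => /andP[/negPf dw /negPf db].
case/andP=> /negPf dx /negPf dy'.
have : d \in nbrs e c by rewrite inE.
case/set2P: cC => ->; first by rewrite nx !inE dw db dy'.
by rewrite ny !inE dw db dx.
Qed.

(** A vertex [x] of degree 3 in a triangle [xyw] can be moved from the class of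
    [y] to that of its third neighbour [b]: a path of the class through [x] can use
    [yw] instead, and the edge [xy] takes over the role of [xb]. *)
Lemma move_to_third_nbr p x y w b : model eH e p -> p x = p y ->
    nbrs e x = [set w; y; b] -> e y w ->
  exists2 p', model eH e p' & p' x = p' b.
Proof.
move=> mp pxy nx yw.
have nE v : e x v = (v \in [set w; y; b]) by rewrite -nx inE.
have [xw xy xb] : [/\ e x w, e x y & e x b] by rewrite !nE !inE !eqxx !orbT.
have [pxb|pxb] := eqVneq (p x) (p b); first by exists p.
have [surj pc pe] := mp.
pose p' := recolour p [set x] (p b).
have p'x : p' x = p b by apply: recolour_in; rewrite inE.
have [yx wx] : y != x /\ w != x by rewrite ![_ == x]eq_sym !neq.
have bx : b != x by rewrite eq_sym neq.
have p'N v : v != x -> p' v = p v by move=> vx; apply: recolour_out; rewrite inE.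
have edge_x v : eH (p x) (p v) -> e x v ->
    exists a c, [/\ p' a = p x, p' c = p v & e a c].
  rewrite [e x v]nE !inE -orbA => uv /or3P[]/eqP vE; move: uv; rewrite vE.
  - by exists y, w; split; rewrite ?p'N.
  - by rewrite pxy eH_irr.
  - by exists y, x; rewrite e_sym xy p'N.
exists p'; last by rewrite p'x p'N.
apply: model_recolour => //.
- by rewrite inE.
- by apply: conn_setU1 (conn1 e x) (set11 x) _ => //; rewrite e_sym.
- move=> u; have [v <-] := surj u; have [->|vx] := eqVneq v x.
    by exists y; rewrite // inE eq_sym (neq xy).
  by exists v; rewrite // inE.
- move=> u; apply: (conn_part_clique (X := mem [set w; y])) (pc u) _ _ _ => //.
  + exact: subsetDl.
  + move=> v a; rewrite !inE => /andP[vx /eqP vu] /eqP au.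
    rewrite au eqxx andbT negbK => /eqP ax; rewrite ax e_sym nE !inE.
    case/orP=> // /eqP vb; case/eqP: pxb.
    by rewrite -ax au -vu vb.
  + move=> a c _ _; rewrite /= !inE => /orP[]/eqP-> /orP[]/eqP->;
    by rewrite ?eqxx // e_sym.
- move=> u v uv; have [a [c [pa pc' ac]]] := pe u v uv.
  have [ax|ax] := eqVneq a x.
    by rewrite -pa -pc' ax; apply: edge_x; rewrite -ax ?pa ?pc'.
  have [cx|cx] := eqVneq c x; last first.
    by exists a, c; split; rewrite -?[recolour _ _ _]/p' ?p'N.
  have [||a' [c' [pa' pc'' ac']]] := @edge_x a.
  - by rewrite -cx pa pc' eH_sym.
  - by rewrite -cx e_sym.
  by exists c', a'; rewrite e_sym -pa -pc' cx.
Qed.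

Hypothesis nowheel : forall w s, 3 <= size s -> uniq (w :: s) ->
  (forall v, v \in s -> e w v /\ #|nbrs e v| = 3) -> ~ cycle e s.

Definition triangle_free_edge x y := forall z, e x z -> ~~ e y z.

(** Let [x :: y :: s] be the rim of a fan with hub [w], and let [b] be the third
    neighbour of [x]. The edge [xb] can be contracted. If it is in a triangle,
    then the triangle contains [w], and the fan extends to [b]. If [b] is on the
    rim already, then it is the last rim vertex, and the graph is a wheel. *)
Lemma fan_contractible p w x y s : model eH e p -> p x = p y ->
    uniq [:: w, x, y & s] -> path e x (y :: s) ->
    (forall v, v \in [:: x, y & s] -> e w v /\ #|nbrs e v| = 3) ->
  exists p' a b, contractible_in_model e eH p' a b /\ triangle_free_edge a b.
Proof.
have [n] := ubnP (#|V| - size s); elim: n => // n IH in p x y s *.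
move=> lt_n mp pxy us pth fan.
have [[wx dx] [wy dy]] : (e w x /\ #|nbrs e x| = 3) /\ (e w y /\ #|nbrs e y| = 3).
  by split; apply: fan; rewrite !inE eqxx ?orbT.
have [xw yw xy] : [/\ e x w, e y w & e x y].
  by rewrite ![e _ w]e_sym; split=> //; case/andP: pth.
have [b [by_ bw nx]] := degree3_third_nbr dx xy xw (neq yw).
have nE v : e x v = (v \in [set w; y; b]) by rewrite -nx inE.
have xb : e x b by rewrite nE !inE eqxx orbT.
have bx : b != x by rewrite eq_sym neq.
have cxb := third_edge_contractible nx yw.
have yb := third_nbr_not_shared nx by_ bw yw dy.
have [p' mp' p'xb] := move_to_third_nbr mp pxy nx yw.
have [bs|bs] := boolP (b \in s).
  case: (@nowheel w [:: x, y & s]) => //.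
    by case: (s) bs.
  case/splitPr: bs us pth fan => s1 s2 us pth fan.
  case: s2 us pth fan => [|c s2] us pth fan.
    by rewrite /cycle rcons_path pth -cat_cons cats1 last_rcons e_sym.
  have := pth; rewrite -cat_cons cat_path /= => /and4P[_ lb bc _].
  (* Otherwise [b] has four neighbours: two on the rim, the hub, and [x]. *)
  have bS : b \in [:: x, y & s1 ++ [:: b, c & s2]].
    by rewrite !inE mem_cat mem_head !orbT.
  have u4 : uniq [:: w; last y s1; c; x].
    have ls := mem_last y s1; set l := last y s1 in ls *.
    have lS : l \in y :: s1 ++ [:: b, c & s2] by rewrite -cat_cons mem_cat ls.
    have cS : c \in y :: s1 ++ [:: b, c & s2].
      by rewrite -cat_cons mem_cat !inE eqxx !orbT.
    move: us; rewrite (cons_uniq w) (cons_uniq x) => /and3P[/memPn wS /memPn xS].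
    rewrite -cat_cons cat_uniq => /and3P[_ /hasPn/(_ c) cN _].
    have lc : l != c.
      by apply: contraTneq ls => ->; apply: cN; rewrite !inE eqxx orbT.
    rewrite /= !inE !negb_or lc (xS l lS) (xS c cS) ![w == _]eq_sym.
    by rewrite (wS x (mem_head _ _)) !(wS _ (mem_behead _)).
  have n4 : {subset [:: w; last y s1; c; x] <= enum (nbrs e b)}.
    move=> v; rewrite mem_enum !inE => /or4P[]/eqP-> //; rewrite e_sym //.
    by have [] := fan b bS.
  by have := uniq_leq_size u4 n4; rewrite -cardE (fan b bS).2.
have [tri|notri] := boolP [exists z, e x z && e b z]; last first.
  exists p', x, b; split=> // z xz; apply: contra notri => bz.
  by apply/existsP; exists z; rewrite xz.
have bw' : e b w.
  case/existsP: tri => z /andP[]; rewrite nE !inE -orbA.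
  by case/or3P=> /eqP-> //; rewrite ?e_irr // [e b y]e_sym (negPf yb).
have db : #|nbrs e b| = 3.
  have H : contractible_in_model e eH p' x b by [].
  exact: triangle_degree3 (contractible_in_model_sym e_sym H) bw' xw.
have usb : uniq [:: w, b, x, y & s].
  move: us; rewrite !cons_uniq !inE !negb_or (negPf bs) bx by_.
  by rewrite [w == b]eq_sym bw.
apply: (IH p' b x (y :: s)) => //.
- have leV : (size s).+4 <= #|V|.
    by have := max_card (mem [:: w, b, x, y & s]); rewrite (card_uniqP usb).
  have {leV} gt0 : 0 < #|V| - size s.
    by rewrite subn_gt0; apply: leq_trans leV; rewrite ltnS -addn3 leq_addr.
  by rewrite subnS -ltnS prednK.
- by rewrite /= e_sym xb.
- by move=> v; rewrite inE => /predU1P[->|/fan //]; rewrite e_sym.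
Qed.

Lemma exists_contractible_triangle_free p : three_conn eH ->
    model eH e p -> #|W| < #|V| ->
  exists p' a b, contractible_in_model e eH p' a b /\ triangle_free_edge a b.
Proof.
move=> eH_3conn mp ltWV.
have [p1 [a [b H]]] := exists_contractible e_sym e_irr e_3conn eH_irr eH_3conn mp ltWV.
have [tri|notri] := boolP [exists z, e a z && e b z]; last first.
  exists p1, a, b; split=> // z az; apply: contra notri => bz.
  by apply/existsP; exists z; rewrite az.
have [w /andP[aw bw]] := existsP tri; have [mp1 ab pab cab] := H.
have da := triangle_degree3 H aw bw.
have db : #|nbrs e b| = 3.
  exact: triangle_degree3 (contractible_in_model_sym e_sym H) bw aw.
apply: (@fan_contractible p1 w a b [::]) => //.
- by rewrite /= !inE negb_or ![w == _]eq_sym !neq.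
- by rewrite /= ab.
- by move=> v; rewrite !inE e_sym => /orP[]/eqP->.
Qed.

End Fans.

(** * Graphs and their adjacency relations *)

Section Adjacency.
Variable G : graph.

Lemma adjP (x y : vert G) :
  reflect (exists e : edge G, ends e = [set x; y]) (adjacent x y).
Proof. by apply: (iffP existsP) => -[e /eqP]; exists e => //; apply/eqP. Qed.

Lemma adj_sym : symmetric (@adjacent G).
Proof. by move=> x y; rewrite /adjacent setUC. Qed.

Lemma adj_irr : simple G -> irreflexive (@adjacent G).
Proof.
case=> c2 _ x; apply/adjP => -[e ex]; have := c2 e.
by rewrite ex setUid cards1.
Qed.

Lemma connected_withoutP (S : {set vert G}) :
  reflect (connected_without S) (conn (@adjacent G) (~: S)).
Proof.
have E : [rel a b : vert G | [&& a \notin S, b \notin S & adjacent a b]] =2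
    within (@adjacent G) (~: S) by move=> a b; rewrite /within /= !in_setC.
apply: (iffP (connP _ _)) => H x y; last first.
  by rewrite !in_setC => xS yS; rewrite -(eq_connect E); apply: H.
by move=> xS yS; rewrite (eq_connect E); apply: H; rewrite in_setC.
Qed.

Lemma three_connectedP : three_connected G <-> three_conn (@adjacent G).
Proof.
split=> -[V4 k]; split=> // S.
  move=> S2; apply: contraLR S2 => /connected_withoutP nS.
  by rewrite -ltnNge; apply: k.
by move=> nS; rewrite ltnNge; apply/negP => /k /connected_withoutP.
Qed.

Lemma adj_endsP (e : edge G) : exists x y, ends e = [set x; y].
Proof.
have /andP[] := ends_card e; case/card_gt0P=> x xe /(set2_of_mem xe)[y ->].
by exists x, y.
Qed.

Lemma simple_ends (e : edge G) : simple G ->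
  exists x y, x != y /\ ends e = [set x; y].
Proof.
case=> c2 _; have [x [y ee]] := adj_endsP e; exists x, y; split=> //.
by have := c2 e; rewrite ee cards2; case: (x != y).
Qed.

Lemma simple_degree (x : vert G) : simple G -> degree x = #|incident x|.
Proof.
case=> c2 _; rewrite /degree; suff -> : [set e : edge G | ends e == [set x]] = set0.
  by rewrite cards0 addn0.
apply/setP => e; rewrite !inE; apply/eqP => ex.
by have := c2 e; rewrite ex cards1.
Qed.

Lemma card_nbrs_incident (x : vert G) : simple G ->
  #|nbrs (@adjacent G) x| = #|incident x|.
Proof.
move=> sG; have [c2 inj] := sG.
rewrite -(card_in_imset (f := fun y => [set x; y]) (D := mem (nbrs _ x))); last first.
  move=> y z; rewrite !inE => xy xz /eqP/set2_eqP[[]//|[xE yE]].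
  by move: xy; rewrite yE adj_irr.
rewrite -(card_imset (mem (incident x)) inj); apply: eq_card => A.
apply/imsetP/imsetP => [[y]|[e]]; rewrite inE.
  by case/adjP=> e ee ->; exists e; rewrite ?inE ?ee // set21.
move=> xe ->; have [y ee] := set2_of_mem xe (eq_leq (c2 e)).
by exists y => //; rewrite inE; apply/adjP; exists e.
Qed.

End Adjacency.

Lemma adj_iso_edge (G H : graph) phi psi (x y : vert G) :
  @is_iso G H phi psi -> adjacent (phi x) (phi y) = adjacent x y.
Proof.
case=> /bij_inj phiI [psi' pK psiK] pe; apply/adjP/adjP => -[e ee]; last first.
  by exists (psi e); rewrite pe ee imsetU !imset_set1.
exists (psi' e); apply: (imset_inj phiI).
by rewrite -pe psiK ee imsetU !imset_set1.
Qed.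

(** In a simple graph an edge is the pair of its ends, so that the map on the
    edges comes for free. *)
Lemma iso_of_adj (G H : graph) (phi : vert G -> vert H) :
    simple G -> simple H -> bijective phi ->
    (forall x y, adjacent (phi x) (phi y) = adjacent x y) ->
  iso G H.
Proof.
move=> sG sH bphi adj; have phiI := bij_inj bphi; have [phi' pK phiK] := bphi.
have psiP (e : edge G) : [exists f : edge H, ends f == phi @: ends e].
  have [x [y ee]] := adj_endsP e.
  have : adjacent (phi x) (phi y) by rewrite adj; apply/adjP; exists e.
  by case/adjP=> f fe; apply/existsP; exists f; rewrite fe ee imsetU !imset_set1.
have psiP' (e : edge G) : exists f : edge H, ends f == phi @: ends e by apply/existsP.
pose psi e := xchoose (psiP' e).
have psiE e : ends (psi e) = phi @: ends e by apply/eqP/(xchooseP (psiP' e)).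
have psiI : injective psi.
  move=> e f ef; apply: sG.2; apply: (imset_inj phiI).
  by rewrite -!psiE ef.
have psiS f : exists e, psi e = f.
  have [x [y fe]] := adj_endsP f.
  have : adjacent (phi (phi' x)) (phi (phi' y)) by apply/adjP; exists f; rewrite !phiK.
  rewrite adj => /adjP[e ee]; exists e; apply: sH.2.
  by rewrite psiE ee fe imsetU !imset_set1 !phiK.
exists phi, psi; split=> //.
apply: inj_card_bij => //; rewrite -!cardsT.
suff -> : [set: edge H] = psi @: [set: edge G] by apply: leq_imset_card.
by apply/esym/setP => f; rewrite inE; have [e <-] := psiS f; apply: imset_f.
Qed.

(** * Minors are models *)

Lemma contract_projE (G : graph) (e : edge G) x y :
  (contract_proj e x == contract_proj e y) =
  (x == y) || (x \in ends e) && (y \in ends e).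
Proof.
rewrite -val_eqE /= /contract_class.
have out (a b : vert G) : a \in ends e -> b \notin ends e ->
    (ends e == [set b]) = (a == b).
  move=> ae be; have -> : (a == b) = false by apply: contraNF be => /eqP<-.
  by apply: contraNF be => /eqP->; rewrite set11.
case: ifP => xe; case: ifP => ye; rewrite ?eqxx ?orbT ?orbF //.
- by apply: out; rewrite ?ye.
- by rewrite eq_sym [RHS]eq_sym; apply: out; rewrite ?xe.
- by rewrite (inj_eq set1_inj).
Qed.

Lemma contract_proj_surj (G : graph) (e : edge G) (u : vert (contract e)) :
  exists x, contract_proj e x = u.
Proof.
case: u => B BI; have /imsetP[x _ xB] := BI.
by exists x; apply: val_inj; rewrite /= xB.
Qed.

(** [K] is [G/f] with the edges of [D] removed: [q] maps the vertices of [G] onto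
    those of [K], and [nm] gives the name in [G] of an edge of [K]. *)
Record reduction (G K : graph) (f : edge G) (D : {set edge G})
    (q : vert G -> vert K) (nm : edge K -> edge G) : Prop := Reduction {
  red_surj : forall u, exists x, q x = u;
  red_eq : forall x y,
    (q x == q y) = (x == y) || (x \in ends f) && (y \in ends f);
  red_inj : injective nm;
  red_codom : forall e, (e \in codom nm) = (e != f) && (e \notin D);
  red_notin : f \notin D;
  red_ends : forall k, ends k = q @: ends (nm k)
}.

Lemma reduction_contract (G : graph) (f : edge G) :
  @reduction G (contract f) f set0 (contract_proj f) val.
Proof.
split=> //; [exact: contract_proj_surj | exact: contract_projE | exact: val_inj | | ].
- move=> e; rewrite inE andbT; apply/codomP/idP => [[[g gf] ->] //|ef].
  by exists (exist _ e ef).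
- by rewrite inE.
Qed.

Lemma reduction_model (G K : graph) f (D : {set edge G}) q nm (r : rel (vert G)) :
    symmetric r ->
    (forall e a b, e \notin D -> ends e = [set a; b] -> r a b) ->
  @reduction G K f D q nm -> model (@adjacent K) r q.
Proof.
move=> rs rD [surj qE _ nmC fD Kends]; split=> [//| u | u v /adjP[k kuv]].
- have [x <-] := surj u; have [fx|fx] := boolP (x \in ends f).
    have [y fxy] := set2_of_mem fx (andP (ends_card f)).2.
    have xy : r x y by apply: rD fxy.
    apply: conn_ext (conn_setU1 rs (conn1 _ y) (set11 y) xy) => v.
    by rewrite !inE qE fx andbT fxy !inE; case: (v == x).
  by apply: conn_ext (conn1 _ x) => v; rewrite !inE qE (negPf fx) andbF orbF.
- have [x [y kxy]] := adj_endsP (nm k).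
  have xy : r x y.
    by apply: rD kxy; have := codom_f nm k; rewrite nmC => /andP[].
  have /eqP/set2_eqP : [set q x; q y] = [set u; v].
    by rewrite -kuv Kends kxy imsetU !imset_set1.
  by case=> -[<- <-]; [exists x, y | exists y, x; rewrite rs].
Qed.

Lemma model_contract_proj (G : graph) (e : edge G) :
  model (@adjacent (contract e)) (@adjacent G) (contract_proj e).
Proof.
apply: reduction_model (reduction_contract e); first exact: adj_sym.
by move=> f a b _ fab; apply/adjP; exists f.
Qed.

Lemma adj_contract_proj (G : graph) (e : edge G) x y : adjacent x y ->
  contract_proj e x = contract_proj e y \/
  @adjacent (contract e) (contract_proj e x) (contract_proj e y).
Proof.
case/adjP=> f fxy; have [fe|fe] := eqVneq f e.
  by left; apply/eqP; rewrite contract_projE -fe fxy set21 set22 orbT.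
right; apply/adjP; exists (exist _ f fe).
by rewrite /= fxy imsetU !imset_set1.
Qed.

Lemma conn_contract (G : graph) (e : edge G) (B : {set vert (contract e)}) :
  conn (@adjacent G) (contract_proj e @^-1: B) -> conn (@adjacent (contract e)) B.
Proof.
move=> /connP cB; apply/connP => a b.
have [x <-] := contract_proj_surj a; have [y <-] := contract_proj_surj b.
move=> xB yB; have := cB x y; rewrite !inE => /(_ xB yB).
apply: (connect_ind (P := fun y => connect _ _ (contract_proj e y))).
  exact: connect0.
move=> c d xc /and3P[]; rewrite !inE => cB' dB /(adj_contract_proj e)[<- //|cd].
by apply: connect_trans xc (connect_within1 _ _ cd).
Qed.

Lemma adj_delete (G : graph) (e : edge G) x y : simple G ->
  ends e = [set x; y] ->
  @adjacent (delete e) =2 del (@adjacent G) x y.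
Proof.
move=> sG ee a b; rewrite /del /=; apply/adjP/andP => [[[f fe] /= fab]|[]].
  split; first by apply/adjP; exists f.
  by apply: contra fe => /eqP abxy; apply/eqP/sG.2; rewrite fab abxy ee.
case/adjP=> f fab nab; have fe : f != e.
  by apply: contraNneq nab => fE; rewrite -fab fE ee.
by exists (exist _ f fe).
Qed.

Lemma adj_deleteS (G : graph) (e : edge G) :
  subrel (@adjacent (delete e)) (@adjacent G).
Proof. by move=> a b /adjP[[f fe] /= fab]; apply/adjP; exists f. Qed.

Lemma adj_delete_other (G : graph) (e : edge G) (x y : vert G) : adjacent x y ->
  ends e <> [set x; y] -> @adjacent (delete e) x y.
Proof.
case/adjP=> f fxy exy; have fe : f != e by apply/eqP => fE; rewrite -fE in exy.
by apply/adjP; exists (exist _ f fe).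
Qed.

Lemma minor_model (H G : graph) : has_minor H G ->
  exists p, model (@adjacent H) (@adjacent G) p.
Proof.
elim=> {G} [G [phi [psi iGH]]|G e _ [p mp]|G e _ [p mp]].
- have [/bij_inj phiI _ _] := iGH; have [[phi' pK phiK] _ _] := iGH.
  exists phi; split=> [u | u | u v uv].
  + by exists (phi' u).
  + apply: conn_ext (conn1 _ (phi' u)) => v.
    by rewrite !inE -(inj_eq phiI) phiK.
  + exists (phi' u), (phi' v); rewrite !phiK; split=> //.
    by rewrite -(adj_iso_edge _ _ iGH) !phiK.
- by exists p; apply: model_mono mp; apply: adj_deleteS.
- exists (p \o contract_proj e); apply: model_comp mp (model_contract_proj e).
  exact: adj_sym.
Qed.

Lemma model_contract (H G : graph) (e : edge G) p :
    irreflexive (@adjacent H) ->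
    model (@adjacent H) (@adjacent G) p -> {in ends e &, forall x y, p x = p y} ->
  exists p', model (@adjacent H) (@adjacent (contract e)) p' /\
    forall x, p' (contract_proj e x) = p x.
Proof.
move=> irr [surj pc pe] pE.
have lift u : exists x, contract_proj e x == u.
  by have [x <-] := contract_proj_surj u; exists x.
pose rep u := xchoose (lift u); pose p' u := p (rep u).
have p'E x : p' (contract_proj e x) = p x.
  have := xchooseP (lift (contract_proj e x)); rewrite -/(rep _) contract_projE.
  by case/orP=> [/eqP|/andP[]]; [rewrite /p' => -> | apply: pE].
exists p'; split=> //; split=> [u | u | u v uv].
- by have [x <-] := surj u; exists (contract_proj e x).
- apply: conn_contract; apply: conn_ext (pc u) => v.
  by rewrite !inE p'E.
- have [x [y [px py xy]]] := pe u v uv.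
  exists (contract_proj e x), (contract_proj e y); rewrite !p'E; split=> //.
  have [Exy|//] := adj_contract_proj e xy.
  by move: uv; rewrite -px -py -p'E Exy p'E irr.
Qed.

(** Contract edges inside classes until the classes are single vertices, and
    then delete edges until only one edge is left for each edge of [H]. *)
Lemma model_minor (H G : graph) p : simple H ->
  model (@adjacent H) (@adjacent G) p -> has_minor H G.
Proof.
move=> sH; have irr := adj_irr sH.
have [n] := ubnP #|edge G|; elim: n => // n IH in G p *.
rewrite ltnS => leEn mp; have [surj pc pe] := mp.
have smaller (e : edge G) : #|{: {e' : edge G | e' != e}}| < n.
  apply: leq_trans leEn; rewrite card_sig [leqRHS](cardD1 e) add1n ltnS.
  by apply: subset_leq_card; apply/subsetP => f; rewrite !inE => ->.
have [pI|] := boolP (injectiveb p); last first.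
  case/injectivePn=> x [y xy pxy].
  have [||||c [d [cA _ dA _ /adjP[e ee]]]] :=
    @conn_exit _ _ _ [set x] x y (pc (p x)).
  - by rewrite inE.
  - by rewrite inE.
  - by rewrite inE pxy.
  - by rewrite inE eq_sym.
  have [|p' [mp' _]] := @model_contract H G e p irr mp.
    move=> a b; rewrite ee; move: cA dA; rewrite !inE => /eqP cu /eqP du.
    by move=> /orP[]/eqP-> /orP[]/eqP->; rewrite ?cu ?du.
  by apply: (@minor_contract _ _ e); apply: IH mp'; apply: smaller.
move/injectiveP in pI.
have lift (f : edge H) : exists e : edge G, p @: ends e == ends f.
  have [u [v fuv]] := adj_endsP f.
  have [|x [y [px py /adjP[e ee]]]] := pe u v; first by apply/adjP; exists f.
  by exists e; rewrite ee imsetU !imset_set1 px py fuv.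
pose g f := xchoose (lift f).
have gE f : p @: ends (g f) = ends f by apply/eqP/(xchooseP (lift f)).
have [gS|] := boolP [forall e, e \in codom g]; last first.
  case/forallPn=> e ge; apply: (@minor_delete _ _ e).
  apply: (IH (delete e) p); first exact: smaller.
  split=> // [u | u v /adjP[f fuv]].
  - have [x px] := surj u; apply: conn_ext (conn1 _ x) => v.
    by rewrite !inE -(inj_eq pI) px.
  - have gfe : g f != e by apply: contraNneq ge => <-; apply: codom_f.
    have [x [y gxy]] := adj_endsP (g f).
    have xy : @adjacent (delete e) x y by apply/adjP; exists (exist _ (g f) gfe).
    have /eqP/set2_eqP : [set p x; p y] = [set u; v].
      by rewrite -fuv -gE gxy imsetU !imset_set1.
    case=> -[<- <-]; first by exists x, y.
    by exists y, x; rewrite adj_sym.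
have gI : injective g by move=> f f' E; apply: sH.2; rewrite -!gE E.
apply: minor_iso.
pose g' e := iinv (forallP gS e).
have gK e : g (g' e) = e by apply: f_iinv.
exists p, g'; split.
- apply: inj_card_bij pI _; exact: model_card mp.
- by exists g => [e|f]; [apply: gK | apply: gI; rewrite gK].
- by move=> e; rewrite -gE gK.
Qed.

(** * Recognizing a wheel *)

Lemma ordS_neq k (i : 'I_k) : 1 < k -> ordS i != i.
Proof.
case: i => m mk k1; rewrite -val_eqE /=; move: mk; rewrite leq_eqVlt.
case/orP=> [/eqP mk|mk]; last by rewrite modn_small // neq_ltn ltnSn orbT.
by rewrite mk modnn neq_ltn -ltnS mk k1.
Qed.

Lemma ordS2_neq k (i : 'I_k) : 2 < k -> ordS (ordS i) != i.
Proof.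
case: i => m mk k2; rewrite -val_eqE /= -addn1 modnDml addn1.
move: mk; rewrite leq_eqVlt => /orP[/eqP mk|].
  have -> : m.+2 = 1 + k by rewrite -mk.
  by rewrite modnDr modn_small ?(ltnW k2) // neq_ltn -ltnS mk k2.
rewrite leq_eqVlt => /orP[/eqP mk|mk].
  by rewrite mk modnn neq_ltn -2!ltnS mk k2.
by rewrite modn_small // neq_ltn leqnSn orbT.
Qed.

Section WheelAdjacency.
Variable k : nat.
Hypothesis k_gt2 : 2 < k.

Lemma wheel_simple : simple (wheel k).
Proof.
have nS (i : 'I_k) : ordS i != i by apply: ordS_neq; apply: ltnW.
split=> [[i|i]|[i|i] [j|j]] /=.
- by rewrite cards2.
- by rewrite cards2 eq_sym (inj_eq Some_inj) nS.
- by move/eqP/set2_eqP => [[_ [->]]|[]].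
- by move/eqP/set2_eqP => [[]|[]].
- by move/eqP/set2_eqP => [[]|[]].
- move/eqP/set2_eqP => [[[->]]|[[ij] [ji]]] //.
  by have := ordS2_neq j k_gt2; rewrite -ij ji eqxx.
Qed.

Lemma wheel_adj_hub (i : 'I_k) : @adjacent (wheel k) None (Some i).
Proof. by apply/adjP; exists (inl i). Qed.

Lemma wheel_adj_rim (i j : 'I_k) :
  @adjacent (wheel k) (Some i) (Some j) = (j == ordS i) || (i == ordS j).
Proof.
apply/adjP/orP => [[[l|l] /= /eqP/set2_eqP]|[]/eqP->].
- by case=> -[].
- by case=> -[[<-] [<-]]; rewrite eqxx; [left|right].
- by exists (inr i).
- by exists (inr j); rewrite /= setUC.
Qed.

End WheelAdjacency.

Lemma cycle_nth (T : eqType) (r : rel T) (x0 : T) (s : seq T) (i : 'I_(size s)) :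
  cycle r s -> r (nth x0 s i) (nth x0 s (ordS i)).
Proof.
case: s i => [[]//|x s] i /(pathP x0)/(_ i).
rewrite size_rcons => /(_ (ltn_ord i)).
rewrite -rcons_cons nth_rcons /= ltn_ord.
have := ltn_ord i; rewrite leq_eqVlt => /orP[/eqP[is_]|].
  by rewrite nth_rcons is_ ltnn eqxx modnn.
by rewrite !ltnS => lt_is; rewrite nth_rcons lt_is modn_small.
Qed.

(** The three neighbours of a rim vertex are the hub and its two neighbours on
    the rim. So there is no vertex outside the wheel, because the hub is not a
    cut vertex. *)
Lemma fan_cycle_wheel (G : graph) (w : vert G) (s : seq (vert G)) :
    simple G -> three_conn (@adjacent G) -> 3 <= size s -> uniq (w :: s) ->
    (forall v, v \in s -> adjacent w v /\ #|nbrs (@adjacent G) v| = 3) ->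
    cycle (@adjacent G) s ->
  iso G (wheel (size s)).
Proof.
move=> sG kG s3 us fan cyc; set k := size s in s3 *.
pose r (i : 'I_k) := nth w s i.
have [ws us'] := andP us.
have rs i : r i \in s by apply: mem_nth.
have rI : injective r.
  by move=> i j /eqP; rewrite /r nth_uniq // => /eqP/val_inj.
have rw i : r i != w by apply: contraNneq ws => <-.
have rS i : adjacent (r i) (r (ordS i)) by apply: cycle_nth.
have nr i : nbrs (@adjacent G) (r i) = [set w; r (ordS i); r (ord_pred i)].
  apply/esym/eqP; rewrite eqEcard (fan _ (rs i)).2; apply/andP; split.
    apply/subsetP => v; rewrite !inE -orbA => /or3P[]/eqP->.
    - by rewrite adj_sym; have [] := fan _ (rs i).
    - exact: rS.
    - by rewrite adj_sym -[X in adjacent _ (r X)]ord_predK.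
  rewrite setUC cardsU1 cards2 !inE negb_or [w == _]eq_sym !rw (inj_eq rI).
  suff -> : ord_pred i != ordS i by [].
  by rewrite -(inj_eq (can_inj (@ordSK k))) ord_predK eq_sym ordS2_neq.
pose theta (u : option 'I_k) := if u is Some i then r i else w.
have thetaI : injective theta.
  case=> [i|] [j|] //=; first by move/rI->.
  - by move/eqP; rewrite (negPf (rw _)).
  - by move/esym/eqP; rewrite (negPf (rw _)).
have thetaS v : exists u, theta u = v.
  have [->|vw] := eqVneq v w; first by exists None.
  suff /(nthP w)[i ik <-] : v \in s by exists (Some (Ordinal ik)).
  apply: contraT => vs; have i0 : 'I_k by exists 0; apply: leq_trans s3.
  have [||||c [d [_ cs dw ds cd]]] :=
    @conn_exit _ _ _ [set u in s] (r i0) v (conn_remove1 w kG).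
  - by rewrite !inE rw.
  - by rewrite inE rs.
  - by rewrite !inE.
  - by rewrite inE.
  move: cs; rewrite inE => /(nthP w)[i ik ci].
  have : d \in nbrs (@adjacent G) (r (Ordinal ik)) by rewrite inE /r /= ci.
  move: dw ds; rewrite nr !inE => /negPf-> ds /=.
  by case/orP=> /eqP dE; rewrite dE rs in ds.
have [phi pK phiK] : bijective theta.
  apply: inj_card_bij thetaI _.
  rewrite -!cardsT; have <- : theta @: [set: option 'I_k] = [set: vert G].
    by apply/setP => v; rewrite inE; have [u <-] := thetaS v; apply: imset_f.
  exact: leq_imset_card.
apply: (@iso_of_adj G (wheel k) phi) => //; first exact: wheel_simple.
  by exists theta.
move=> x y; rewrite -[in RHS](phiK x) -[in RHS](phiK y).
have wi i : adjacent w (r i) by have [] := fan _ (rs i).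
case: (phi x) => [i|]; case: (phi y) => [j|].
- rewrite wheel_adj_rim.
  have -> : @adjacent G (theta (Some i)) (theta (Some j)) =
      (r j \in nbrs (@adjacent G) (r i)) by rewrite inE.
  rewrite nr !inE (negPf (rw j)) !(inj_eq rI).
  by rewrite -[j == ord_pred i](inj_eq (can_inj (@ordSK k))) ord_predK
    [ordS j == _]eq_sym.
- by rewrite adj_sym wheel_adj_hub adj_sym wi.
- by rewrite wheel_adj_hub /= wi.
- by rewrite !adj_irr //; apply: wheel_simple.
Qed.

(** * Reductions of a graph by one edge *)

Lemma reduction_delete (G K : graph) f (D : {set edge G}) q nm (k : edge K) :
  reduction f D q nm ->
  @reduction G (delete k) f (nm k |: D) q (fun k' => nm (val k')).
Proof.
move=> [surj qE nmI nmC fD Kends]; split=> //.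
- by move=> k1 k2 /nmI /val_inj.
- move=> e; rewrite in_setU1 negb_or; apply/codomP/and3P => [[[g gk] ->]|[ef ek eD]].
    by have := codom_f nm g; rewrite nmC (inj_eq nmI) => /andP[].
  have /codomP[g eg] : e \in codom nm by rewrite nmC ef.
  have gk : g != k by rewrite -(inj_eq nmI) -eg.
  by exists (exist _ g gk).
- rewrite in_setU1 negb_or fD andbT eq_sym.
  by have := codom_f nm k; rewrite nmC => /andP[].
- by move=> g; apply: Kends.
Qed.

Definition add_name (G K : graph) (nm : edge K -> edge G) (e : edge G)
    (a b : vert K) (o : edge (add_edge K a b)) : edge G :=
  if o is Some k then nm k else e.
Arguments add_name [G K] nm e a b o.

Lemma reduction_add (G K : graph) f (D : {set edge G}) q nm e a b :
    reduction f D q nm -> e \in D -> ends e = [set a; b] ->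
  @reduction G (add_edge K (q a) (q b)) f (D :\ e) q (add_name nm e (q a) (q b)).
Proof.
move=> [surj qE nmI nmC fD Kends] eD eab.
have ef : e != f by apply: contraNneq fD => <-.
have nme k : nm k != e.
  by have := codom_f nm k; rewrite nmC => /andP[_]; apply: contraNneq => ->.
split=> //.
- move=> [k1|] [k2|] // => [/nmI ->//|/eqP|/esym/eqP]; by rewrite (negPf (nme _)).
- move=> g; rewrite in_setD1 negb_and negbK.
  apply/codomP/andP => [[[k|] ->]|[gf]].
  + by have := codom_f nm k; rewrite nmC => /andP[-> ->]; rewrite orbT.
  + by rewrite eqxx.
  + case/orP=> [/eqP ->|gD]; first by exists None.
    have /codomP[k gk] : g \in codom nm by rewrite nmC gf.
    by exists (Some k).
- by rewrite in_setD1 (negPf fD) andbF.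
- by case=> [k|] //=; rewrite eab imsetU !imset_set1.
Qed.

Section Reduction.
Variables (G : graph) (f : edge G) (x y : vert G).
Hypotheses (G_simple : simple G) (G_3conn : three_conn (@adjacent G)).
Hypotheses (fxy : ends f = [set x; y]) (xy : x != y).

Lemma in_ends_f v : (v \in ends f) = (v == x) || (v == y).
Proof. by rewrite fxy !inE. Qed.

Lemma adj_f : adjacent x y.
Proof. by apply/adjP; exists f. Qed.

Section Fixed.
Variables (K : graph) (D : {set edge G}) (q : vert G -> vert K)
  (nm : edge K -> edge G).
Hypothesis red : reduction f D q nm.

(** The vertex obtained from [f] is to be split into [x], which keeps its name,
    and [y], the new vertex [None]. *)
Definition split_vert (v : vert G) : option (vert K) :=
  if v == y then None else Some (q v).

Lemma split_vert_bij : bijective split_vert.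
Proof.
have [surj qE _ _ _ _] := red.
have inj : injective split_vert.
  move=> u v; rewrite /split_vert; case: eqP => [->|uy]; case: eqP => [->|vy] //.
  case=> /eqP; rewrite qE !in_ends_f.
  case/orP=> [/eqP //|/andP[/orP[]/eqP uE /orP[]/eqP vE]] //.
  by rewrite uE vE.
have sur o : exists v, split_vert v = o.
  case: o => [u|]; last by exists y; rewrite /split_vert eqxx.
  have [v <-] := surj u; have [vy|vy] := eqVneq v y.
    exists x; rewrite /split_vert (negPf xy); congr Some; apply/eqP.
    by rewrite qE !in_ends_f vy !eqxx !orbT.
  by exists v; rewrite /split_vert (negPf vy).
apply: inj_card_bij inj _; rewrite -!cardsT.
have <- : split_vert @: [set: vert G] = [set: option (vert K)].
  by apply/setP => o; rewrite inE; have [v <-] := sur o; apply: imset_f.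
exact: leq_imset_card.
Qed.

Lemma reduction_card_vert : #|vert G| = #|vert K| + 1.
Proof. by rewrite (bij_eq_card split_vert_bij) card_option addn1. Qed.

Definition split_name (o : option (edge K)) : edge G :=
  if o is Some k then nm k else f.

(** A vertex [v] with [q v = q x] other than [y] can only be [x], and an edge at
    [x] is not assigned to the new vertex, because [f] has no parallel edge. *)
Lemma split_iso : D = set0 ->
  exists phi, @is_iso (split_graph (q x) (fun k => y \in ends (nm k))) G
    phi split_name.
Proof.
move=> D0; have [surj qE nmI nmC _ Kends] := red.
have [phi sK phiK] := split_vert_bij; exists phi; split.
- by exists split_vert.
- have inj : injective split_name.
    have nmf k : nm k != f by have := codom_f nm k; rewrite nmC => /andP[].
    by move=> [k1|] [k2|] //= => [/nmI ->//|/eqP|/esym/eqP]; rewrite (negPf (nmf _)).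
  have sur e : exists o, split_name o = e.
    have [->|ef] := eqVneq e f; first by exists None.
    have /codomP[k ek] : e \in codom nm by rewrite nmC ef D0 inE.
    by exists (Some k).
  apply: inj_card_bij inj _; rewrite -!cardsT.
  have <- : split_name @: [set: option (edge K)] = [set: edge G].
    by apply/setP => e; rewrite inE; have [o <-] := sur e; apply: imset_f.
  exact: leq_imset_card.
- move=> o; apply: (imset_inj (can_inj sK)).
  rewrite -imset_comp (eq_imset (g := id)) => [|u]; last exact: phiK.
  rewrite imset_id; case: o => [k|] /=; last first.
    by rewrite fxy imsetU !imset_set1 /split_vert eqxx (negPf xy).
  rewrite Kends -imset_comp; apply: eq_in_imset => v vk /=.
  rewrite /split_vert /split_end; case: eqP => [vy|/eqP vy].
    by rewrite -vy vk andbT qE !in_ends_f vy !eqxx !orbT.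
  case: ifP => // /andP[]; rewrite qE !in_ends_f !eqxx (negPf vy) !orbF.
  have -> : (v == x) || (v == x) && true = (v == x) by rewrite andbT orbb.
  move=> /eqP vx yk; have : nm k != f.
    by have := codom_f nm k; rewrite nmC => /andP[].
  case/eqP; apply: G_simple.2; apply/esym/eqP; rewrite eqEcard fxy.
  rewrite (G_simple.1 (nm k)) cards2 xy andbT.
  by apply/subsetP => u; rewrite !inE => /orP[]/eqP->; rewrite -?vx.
Qed.

Lemma reduction_incident k v :
  k \in incident (q v) -> exists2 u : vert G, nm k \in incident u & q u = q v.
Proof.
have [_ _ _ _ _ Kends] := red.
by rewrite inE Kends => /imsetP[u ku ->]; exists u; rewrite ?inE.
Qed.

Lemma reduction_incident_f k : k \in incident (q x) ->
  nm k \in (incident x :|: incident y) :\ f.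
Proof.
have [_ qE _ nmC _ _] := red => /reduction_incident[u ku /eqP].
have nmf : nm k != f by have := codom_f nm k; rewrite nmC => /andP[].
rewrite qE !in_ends_f !inE nmf /= eqxx !andbT; move: ku; rewrite inE => ku.
by case/orP=> [/eqP <-|/orP[]/eqP <-]; rewrite ku ?orbT.
Qed.

Lemma incident_f t : t \in ends f -> f \in incident t.
Proof. by rewrite inE. Qed.

Lemma card_incident_ge3 (v : vert G) : 3 <= #|incident v|.
Proof.
by rewrite -card_nbrs_incident //; apply: three_conn_nbrs => //; apply: adj_irr.
Qed.

Lemma incident_fI : incident x :&: incident y = [set f].
Proof.
apply/setP => e; rewrite !inE; apply/andP/eqP => [[xe ye]|->]; last first.
  by rewrite !in_ends_f !eqxx orbT.
apply: G_simple.2; apply/esym/eqP; rewrite eqEcard (G_simple.1 e) fxy.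
rewrite cards2 xy andbT.
by apply/subsetP => u; rewrite !inE => /orP[]/eqP->.
Qed.

(** The ends of [f] have degree at least 3 each, and share no edge but [f]. *)
Lemma reduction_degree : D = set0 -> 4 <= degree (q x).
Proof.
move=> D0; have [_ _ nmI nmC _ Kends] := red.
apply: leq_trans (leq_addr _ _).
have sub : (incident x :|: incident y) :\ f \subset nm @: incident (q x).
  apply/subsetP => e; rewrite !inE => /andP[ef exy].
  have /codomP[k ek] : e \in codom nm by rewrite nmC ef D0 inE.
  apply/imsetP; exists k => //; rewrite inE Kends -ek.
  case/orP: exy => [xe|ye]; first exact: imset_f.
  apply/imsetP; exists y => //; apply/eqP; have [_ -> _ _ _ _] := red.
  by rewrite !in_ends_f !eqxx !orbT.
have := subset_leq_card sub; rewrite card_imset //; apply: leq_trans.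
have fU : f \in incident x :|: incident y by rewrite !inE in_ends_f eqxx.
have := cardsUI (incident x) (incident y); rewrite incident_fI cards1.
rewrite (cardsD1 f) fU => E; rewrite -(leq_add2r 2).
set n := #|_ :\ f| in E *; have -> : n + 2 = #|incident x| + #|incident y|.
  by rewrite -E add1n addn1 addn2.
by apply: (@leq_add 3 3); apply: card_incident_ge3.
Qed.

Lemma reduction_split : D = set0 -> vertex_split K G split_name.
Proof.
move=> D0; have [phi isoG] := split_iso D0.
have deg u : 3 <= @degree (split_graph (q x) (fun k => y \in ends (nm k))) u.
  have [/bij_inj phiI [psi' _ psiK] E] := isoG.
  apply: leq_trans (leq_addr _ _); apply: leq_trans (leq_imset_card split_name _).
  apply: leq_trans (card_incident_ge3 (phi u)) (subset_leq_card _).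
  apply/subsetP => e; rewrite inE -(psiK e) E => /imsetP[v vu /phiI uv].
  by apply/imsetP; exists (psi' e); rewrite // inE uv.
exists (q x), (fun k => y \in ends (nm k)), phi; split=> //.
exact: reduction_degree.
Qed.

Hypothesis no_triangle : triangle_free_edge (@adjacent G) x y.

(** Two edges that become parallel form a triangle with [f]. *)
Lemma contract_ends_inj e1 e2 : e1 != f -> e2 != f ->
  q @: ends e1 = q @: ends e2 -> e1 = e2.
Proof.
have [_ qE _ _ _ _] := red.
have [a [b [ab e1E]]] := simple_ends e1 G_simple.
have [c [d [cd e2E]]] := simple_ends e2 G_simple.
move=> e1f e2f; rewrite e1E e2E !imsetU !imset_set1.
wlog: c d cd e2E / q a = q c /\ q b = q d.
  move=> W /eqP/set2_eqP[] [ac bd].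
    by apply: (W c d) => //; rewrite ac bd.
  by apply: (W d c) => //; [rewrite eq_sym | rewrite setUC | rewrite ac bd].
case=> /eqP; rewrite qE => ac /eqP; rewrite qE => bd _.
have ff u v e : u != v -> ends e = [set u; v] -> u \in ends f -> v \in ends f ->
    e = f.
  move=> uv ee uf vf; apply: G_simple.2; apply/eqP; rewrite eqEcard !G_simple.1.
  by rewrite andbT; apply/subsetP => t; rewrite ee !inE => /orP[]/eqP->.
have tri u v w : u \in ends f -> v \in ends f -> u != v -> adjacent u w ->
    adjacent v w -> False.
  rewrite !in_ends_f => /orP[]/eqP-> /orP[]/eqP->; rewrite ?eqxx // => _ uw vw.
    by have := no_triangle uw; rewrite vw.
  by have := no_triangle vw; rewrite uw.
have adj1 : adjacent a b by apply/adjP; exists e1.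
have adj2 : adjacent c d by apply/adjP; exists e2.
have [ac'|ac'] := eqVneq a c; have [bd'|bd'] := eqVneq b d.
- by apply: G_simple.2; rewrite e1E e2E ac' bd'.
- move: bd; rewrite (negPf bd') /= => /andP[bf df].
  by case: (tri b d a) => //; rewrite adj_sym // ac'.
- move: ac; rewrite (negPf ac') /= => /andP[af cf].
  by case: (tri a c b) => //; rewrite bd'.
- move: ac bd; rewrite (negPf ac') (negPf bd') /= => /andP[af _] /andP[bf _].
  by case/eqP: e1f; apply: ff e1E af bf.
Qed.

Lemma reduction_simple : simple K.
Proof.
have [_ qE nmI nmC _ Kends] := red.
have nmf k : nm k != f by have := codom_f nm k; rewrite nmC => /andP[].
split=> [k|k1 k2].
  have [a [b [ab kE]]] := simple_ends (nm k) G_simple.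
  rewrite Kends kE imsetU !imset_set1 cards2 qE (negPf ab) /=.
  suff -> : (a \in ends f) && (b \in ends f) = false by [].
  apply: contraNF (nmf k) => /andP[af bf]; apply/eqP/G_simple.2/eqP.
  rewrite eqEcard !G_simple.1 andbT kE.
  by apply/subsetP => t; rewrite !inE => /orP[]/eqP->.
by rewrite !Kends => /contract_ends_inj => /(_ (nmf _) (nmf _))/nmI.
Qed.

Lemma reduction_nonadjacent e a b : e \in D -> ends e = [set a; b] ->
  nonadjacent K (q a) (q b).
Proof.
have [_ qE nmI nmC fD Kends] := red.
move=> eD eab; have ef : e != f by apply: contraNneq fD => <-.
apply/andP; split.
  rewrite qE negb_or.
  have -> : a != b by have := G_simple.1 e; rewrite eab cards2; case: (a == b).
  apply: contra ef => /andP[af bf]; apply/eqP/G_simple.2/eqP.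
  rewrite eqEcard !G_simple.1 andbT eab.
  by apply/subsetP => t; rewrite !inE => /orP[]/eqP->.
apply/adjP => -[k]; rewrite Kends => kE.
have := codom_f nm k; rewrite nmC => /andP[kf].
rewrite (@contract_ends_inj (nm k) e) ?eD //.
by rewrite kE eab imsetU !imset_set1.
Qed.

Variable H : graph.
Hypotheses (H_simple : simple H) (G_nodel : forall e, ~ deletable H G e).
Hypotheses (K_3conn : three_connected K) (K_minor : has_minor H K).

(** Restoring [f] in [K] gives a spanning subgraph of [G] without [e]. So the
    latter has the minor, and, as [e] is not deletable, it must fail to be
    three-connected, which can only be due to a small degree at an end of [f]. *)
Lemma removed_edge_end e : e \in D ->
  exists t, [/\ t \in ends f, t \in ends e & #|incident t| = 3].
Proof.
move=> eD; have [surj qE nmI nmC fD Kends] := red.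
have ef : e != f by apply: contraNneq fD => <-.
have [a [b [ab eab]]] := simple_ends e G_simple.
pose r := @adjacent (delete e).
have rS : symmetric r by apply: adj_sym.
have rxy : r x y.
  apply: adj_delete_other adj_f _; rewrite -fxy => /G_simple.2 E.
  by rewrite E eqxx in ef.
have mq : model (@adjacent K) r q.
  apply: reduction_model red => // g c d gD gE.
  have ge : g != e by apply: contraNneq gD => ->.
  by apply/adjP; exists (exist _ g ge).
have [|none] := boolP
    [exists t, [&& t \in ends f, t \in ends e & #|incident t| == 3]].
  by case/existsP=> t /and3P[tf te /eqP t3]; exists t.
have degr t : t \in ends f -> 3 <= #|nbrs r t|.
  move=> tf; have sub c : nbrs (@adjacent G) t :\ c \subset nbrs r t -> t \in ends e ->
      3 <= #|nbrs r t|.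
    move=> /subset_leq_card le te; apply: leq_trans le.
    have : 3 < #|nbrs (@adjacent G) t|.
      rewrite ltn_neqAle card_nbrs_incident // card_incident_ge3 andbT eq_sym.
      by have /existsPn/(_ t) := none; rewrite tf te.
    by rewrite (cardsD1 c); case: (_ \in _); rewrite ?add0n // => /ltnW.
  have [te|te] := boolP (t \in ends e).
    have [c ec] := set2_of_mem te (eq_leq (G_simple.1 e)).
    apply: (sub c) => //; apply/subsetP => d; rewrite !inE => /andP[dc td].
    apply: adj_delete_other td _; rewrite ec => E.
    by have := set22 t d; rewrite -E !inE (negPf dc) orbF => /eqP dt;
       have := set22 t c; rewrite E dt !inE orbb => /eqP ct;
       rewrite ct dt eqxx in dc.
  apply: leq_trans (three_conn_nbrs t (adj_irr G_simple) G_3conn) (subset_leq_card _).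
  apply/subsetP => d; rewrite !inE => td; apply: adj_delete_other td _ => E.
  by rewrite E set21 in te.
have [K4 kK] := (three_connectedP K).1 K_3conn.
case: (@G_nodel e); split; last first.
  have [p mp] := minor_model K_minor.
  by apply: (@model_minor H (delete e) (p \o q)) => //; apply: model_comp mp mq.
apply/three_connectedP; apply: (@uncontract_3conn _ _ x y) => //.
- by move=> c; apply: contraFF (adj_irr G_simple c); apply: adj_deleteS.
- by have [] := G_3conn.
- by apply: degr; rewrite in_ends_f eqxx.
- by apply: degr; rewrite in_ends_f eqxx orbT.
- move=> z; have cz := kK [set q x; q z] (card_set2 _ _).
  apply: conn_ext (model_preim_conn rS mq cz) => v.
  rewrite !inE !qE !in_ends_f eqxx andbT.
  by case: (v == x); case: (v == y); rewrite ?orbT ?orbF.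
- move=> S S2 xS yS.
  have S2' : #|q @: S| <= 2 by apply: leq_trans (leq_imset_card _ _) S2.
  apply: conn_ext (model_preim_conn rS mq (kK _ S2')) => v.
  rewrite !inE; congr negb; apply/imsetP/idP => [[u uS /eqP]|vS]; last by exists v.
  rewrite qE !in_ends_f => /orP[/eqP-> //|/andP[_ /orP[]/eqP uE]].
    by rewrite uE (negPf xS) in uS.
  by rewrite uE (negPf yS) in uS.
Qed.

(** If the edges of [D] did not all meet [f] at the same end, then both ends of
    [f] would have degree 3 and lose an edge, so that the vertex of [K] obtained
    from [f] would have degree at most 2. *)
Lemma removed_edges_incident : D != set0 ->
  exists t, [/\ t \in ends f, #|incident t| = 3 & D \subset incident t :\ f].
Proof.
have [_ _ nmI nmC fD _] := red.
case/set0Pn=> e eD; have [t [tf te t3]] := removed_edge_end eD.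
exists t; split=> //; apply/subsetP => g gD.
have gf : g != f by apply: contraNneq fD => <-.
have ef : e != f by apply: contraNneq fD => <-.
rewrite in_setD1 gf inE /=; apply: contraT => tg.
have [u [uf ug u3]] := removed_edge_end gD.
have one s d : s \in ends f -> s \in ends d -> #|incident s| = 3 -> d != f ->
    #|incident s :\ f :\ d| <= 1.
  move=> sf sd s3 df; move: s3; rewrite (cardsD1 f) incident_f // (cardsD1 d).
  by rewrite in_setD1 df inE sd !add1n => -[->].
have inc : nm @: incident (q x) \subset
    (incident t :\ f :\ e) :|: (incident u :\ f :\ g).
  apply/subsetP => _ /imsetP[k /reduction_incident_f kx ->].
  have kD : nm k \notin D by have := codom_f nm k; rewrite nmC => /andP[].
  have ke : nm k != e by apply: contraNneq kD => ->.
  have kg : nm k != g by apply: contraNneq kD => ->.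
  move: kx; rewrite !inE ke kg => /andP[-> kxy] /=.
  have ut : u != t by apply: contraNneq tg => <-.
  move: tf uf ut kxy; rewrite !in_ends_f => /orP[]/eqP-> /orP[]/eqP->;
    by rewrite ?eqxx // orbC.
have := leq_trans (subset_leq_card inc) (leq_card_setU _ _).1.
rewrite card_imset // => le2.
have sK := reduction_simple; have kK := (three_connectedP K).1 K_3conn.
have := three_conn_nbrs (q x) (adj_irr sK) kK; rewrite card_nbrs_incident // leqNgt.
case/negP; rewrite ltnS; apply: leq_trans le2 _.
by apply: (@leq_add _ _ 1 1); apply: one.
Qed.

Lemma removed_edges_card : #|D| <= 2.
Proof.
have [->|/removed_edges_incident[t [tf t3 Dt]]] := eqVneq D set0.
  by rewrite cards0.
apply: leq_trans (subset_leq_card Dt) _; move: t3.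
by rewrite (cardsD1 f) incident_f // add1n => -[->].
Qed.

Lemma reduction_card_edge : #|edge G| <= #|edge K| + 3.
Proof.
have [_ _ nmI nmC _ _] := red.
rewrite -(card_codom nmI) -(cardsC (f |: D)) addnC; apply: leq_add.
  apply: subset_leq_card; apply/subsetP => e; rewrite in_setC in_setU1 negb_or.
  by rewrite nmC.
rewrite cardsU1; apply: (@leq_add _ _ 1 2); last exact: removed_edges_card.
by case: (_ \notin _).
Qed.

End Fixed.
End Reduction.

(** * Contracting an edge and removing what becomes deletable *)

(** A cut of [G/f] through the vertex obtained from [f] is a cut [x], [y], [z] of
    [G], and any other one is a cut of [G] of the same size. *)
Lemma contract_three_connected (G : graph) (f : edge G) x y :
    simple G -> three_conn (@adjacent G) -> 5 <= #|vert G| ->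
    ends f = [set x; y] -> x != y -> contractible (@adjacent G) x y ->
  three_connected (contract f).
Proof.
move=> sG kG V5 fxy xy /forallP cxy; apply/three_connectedP; split=> [|S S2].
  have := reduction_card_vert fxy xy (reduction_contract f).
  by move: V5; rewrite addn1 => + E; rewrite E.
pose q := contract_proj f; apply: conn_contract.
have qE u v : (q u == q v) = (u == v) || (u \in ends f) && (v \in ends f).
  exact: contract_projE.
have [xS|xS] := boolP (q x \in S).
  have [u ->] := set2_of_mem xS S2; have [z <-] := contract_proj_surj u.
  apply: conn_ext (cxy z) => v; rewrite !inE !qE !(in_ends_f fxy) eqxx andbT.
  by case: (v == x); case: (v == y); rewrite ?orbT ?orbF.
have [_ k] := kG; have /k : #|q @^-1: S| <= 2.
  apply: leq_trans S2; rewrite -(card_in_imset (f := q)) => [|u v].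
    by apply: subset_leq_card; apply/subsetP => _ /imsetP[v + ->]; rewrite inE.
  rewrite !inE => uS _ /eqP; rewrite qE => /orP[/eqP //|/andP[uf _]].
  case/negP: xS; suff /eqP <- : q u == q x by [].
  by rewrite qE uf (in_ends_f fxy) eqxx orbT.
by apply: conn_ext => v; rewrite !inE.
Qed.

(** Delete edges as long as possible. *)
Lemma exists_undeletable_reduction (G H K : graph) (f : edge G) (D : {set edge G})
    q nm : @reduction G K f D q nm -> three_connected K -> has_minor H K ->
  exists (K' : graph) (D' : {set edge G}) (q' : vert G -> vert K')
    (nm' : edge K' -> edge G),
    [/\ reduction f D' q' nm', three_connected K', has_minor H K'
      & forall e, ~ deletable H K' e].
Proof.
have [n] := ubnP #|edge K|; elim: n => // n IH in K D q nm *.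
move=> ltn red kK mK.
have [[e [ke me]]|none] := classic (exists e, deletable H K e); last first.
  by exists K, D, q, nm; split=> // e de; apply: none; exists e.
apply: (IH (delete e) _ _ _ _ (reduction_delete e red)) => //.
rewrite ltnS in ltn; apply: leq_trans ltn; rewrite card_sig.
apply: proper_card; apply/properP; split; first exact/subsetP.
by exists e; rewrite ?inE ?eqxx.
Qed.

(** With as many vertices as [G], the minor would be a spanning subgraph of [G]
    that misses some edge of [G], and such an edge would be deletable. *)
Lemma proper_minor_card (G H : graph) :
    simple G -> simple H -> three_connected H -> has_proper_minor H G ->
    (forall e : edge G, ~ deletable H G e) ->
  #|vert H| < #|vert G|.
Proof.
move=> sG sH kH [/minor_model[p mp] niso] nodel.
have [surj pc pe] := mp.
rewrite ltn_neqAle (model_card mp) andbT; apply/eqP => EV.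
have pI : injective p.
  suff /imset_injP pI : #|p @: [set: vert G]| == #|[set: vert G]|.
    by move=> u v; apply: pI; rewrite inE.
  suff -> : p @: [set: vert G] = [set: vert H] by rewrite !cardsT EV.
  by apply/setP => u; rewrite inE; have [v <-] := surj u; apply: imset_f.
have [hom|] := boolP [forall x, forall y, adjacent x y ==> adjacent (p x) (p y)].
  apply: niso; apply: (iso_of_adj (phi := p)) => // [|x y].
    by apply: inj_card_bij => //; rewrite EV.
  apply/idP/idP => [/pe[a [b [/pI-> /pI-> //]]]|].
  by move: (forallP hom x) => /forallP/(_ y)/implyP.
case/forallPn=> x /forallPn[y]; rewrite negb_imply => /andP[/adjP[e exy] nxy].
have me : model (@adjacent H) (@adjacent (delete e)) p.
  split=> // [u | u v uv].
    have [x' <-] := surj u; apply: conn_ext (conn1 _ x') => v.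
    by rewrite !inE (inj_eq pI).
  have [a [b [pa pb ab]]] := pe u v uv; exists a, b; split=> //.
  apply: adj_delete_other ab _; rewrite exy => /eqP/set2_eqP.
  by case=> -[ax by_]; move: nxy; rewrite ax by_ pa pb ?uv // adj_sym uv.
apply: (nodel e); split; last exact: model_minor me.
apply/three_connectedP.
apply: (@model_inj_3conn _ _ (@adjacent H) (@adjacent (delete e)) p) => //.
  exact: adj_sym.
exact/three_connectedP.
Qed.

Lemma undeletable_del (G H : graph) x w p : simple G -> simple H ->
    (forall e : edge G, ~ deletable H G e) -> adjacent x w ->
    model (@adjacent H) (del (@adjacent G) x w) p ->
  ~ three_conn (del (@adjacent G) x w).
Proof.
move=> sG sH nodel /adjP[e exw] mp [V4 k]; apply: (nodel e).
have E := adj_delete sG exw; split.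
  apply/three_connectedP; split=> // S S2.
  by apply: conn_mono (k S S2) => a b _ _; rewrite E.
apply: (@model_minor H (delete e) p) => //.
by apply: model_mono mp => a b; rewrite E.
Qed.

Theorem theorem3p2 (G H : graph)
    (G_simple : simple G) (G_3conn : three_connected G)
    (H_simple : simple H) (H_3conn : three_connected H)
    (G_not_wheel : forall n : nat, 4 <= n -> ~ iso G (wheel n.-1))
    (H_not_W3 : ~ iso H (wheel 3))
    (GH_minor : has_proper_minor H G)
    (G_nodel : forall e : edge G, ~ deletable H G e) :
  exists G' : graph,
    [/\ simple G', three_connected G', has_minor H G'
      & forall e : edge G', ~ deletable H G' e] /\
    ((exists psi : option (edge G') -> edge G, vertex_split G' G psi)
     \/
     (exists (x y : vert G')
             (psi : option (edge (add_edge G' x y)) -> edge G),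
        [/\ nonadjacent G' x y,
            vertex_split (add_edge G' x y) G psi
          & exists2 T : {set edge G}, triad T &
              (psi (Some None) \in T) && (psi None \in T)])
     \/
     (exists (x1 y1 x2 y2 : vert G')
             (psi : option (edge (add_edge (add_edge G' x1 y1) x2 y2)) ->
                    edge G),
        [/\ nonadjacent G' x1 y1,
            nonadjacent (add_edge G' x1 y1) x2 y2,
            vertex_split (add_edge (add_edge G' x1 y1) x2 y2) G psi
          & triad [set psi (Some (Some None)); psi (Some None); psi None]])) /\
    #|vert G| = #|vert G'| + 1 /\ #|edge G| <= #|edge G'| + 3.
Proof.
have kG := (three_connectedP G).1 G_3conn.
have kH := (three_connectedP H).1 H_3conn.
have [irrG irrH] := (adj_irr G_simple, adj_irr H_simple).
have ltHG := proper_minor_card G_simple H_simple H_3conn GH_minor G_nodel.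
have V5 : 5 <= #|vert G| by apply: leq_ltn_trans ltHG; case: H_3conn.
have [p0 mp0] := minor_model GH_minor.1.
have [|p [x [y [[mp xy pxy cxy] tri]]]] := exists_contractible_triangle_free
  (@adj_sym G) irrG kG V5 (@adj_sym H) irrH
  (fun x w p => @undeletable_del G H x w p G_simple H_simple G_nodel) _ kH mp0 ltHG.
  move=> w s s3 us fan cyc; apply: (G_not_wheel (size s).+1) => //.
  exact: fan_cycle_wheel fan cyc.
have [f fxy] := adjP _ _ xy.
have nxy : x != y by apply: contraTneq xy => ->; rewrite irrG.
have k0 : three_connected (contract f).
  exact: (contract_three_connected G_simple kG V5 fxy nxy cxy).
have m0 : has_minor H (contract f).
  have [|p' [mp' _]] := @model_contract H G f p irrH mp; last first.
    exact: model_minor mp'.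
  by move=> a b; rewrite fxy !inE => /orP[]/eqP-> /orP[]/eqP->.
have [K [D [q [nm [red kK mK nodK]]]]] :=
  exists_undeletable_reduction (reduction_contract f) k0 m0.
exists K; split.
  by split=> //; apply: (reduction_simple G_simple fxy red tri).
split; last first.
  split; first exact: (reduction_card_vert fxy nxy red).
  exact: (reduction_card_edge G_simple kG fxy red tri H_simple G_nodel kK mK).
have [D0|Dn0] := eqVneq D set0.
  left; exists (split_name f nm).
  exact: (reduction_split G_simple kG fxy nxy red D0).
have [t [tf t3 Dt]] := removed_edges_incident G_simple kG fxy red tri
  H_simple G_nodel kK mK Dn0.
have D2 := removed_edges_card G_simple kG fxy red tri H_simple G_nodel kK mK.
have triadT : triad (incident t).
  by split=> //; exists t; rewrite ?simple_degree.
have DT e : e \in D -> e \in incident t.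
  by move/(subsetP Dt); rewrite in_setD1 => /andP[].
have fT : f \in incident t by rewrite inE.
right; have /orP[/cards1P[e DE]|/cards2P[e1 [e2 [ne12 DE]]]] :
  (#|D| == 1) || (#|D| == 2).
  move: D2 Dn0; rewrite -card_gt0; by case: #|D| => [|[|[|]]].
- left; have eD : e \in D by rewrite DE set11.
  have [a [b [ab eab]]] := simple_ends e G_simple.
  have red1 := reduction_add red eD eab.
  exists (q a), (q b), (split_name f (add_name nm e (q a) (q b))).
  split.
  + exact: (reduction_nonadjacent G_simple fxy red tri eD eab).
  + by apply: (reduction_split G_simple kG fxy nxy red1); rewrite DE setDv.
  + by exists (incident t); rewrite //= DT.
- right; have [e1D e2D] : e1 \in D /\ e2 \in D by rewrite DE set21 set22.
  have [a1 [b1 [_ e1ab]]] := simple_ends e1 G_simple.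
  have [a2 [b2 [_ e2ab]]] := simple_ends e2 G_simple.
  have red1 := reduction_add red e1D e1ab.
  have e2D1 : e2 \in D :\ e1 by rewrite in_setD1 eq_sym ne12.
  have red2 := reduction_add red1 e2D1 e2ab.
  have D12 : D :\ e1 :\ e2 = set0.
    by apply/setP => e; rewrite DE !inE; case: (e == e1); case: (e == e2).
  exists (q a1), (q b1), (q a2), (q b2).
  exists (split_name f (add_name (add_name nm e1 (q a1) (q b1)) e2 (q a2) (q b2))).
  split.
  + exact: (reduction_nonadjacent G_simple fxy red tri e1D e1ab).
  + exact: (reduction_nonadjacent G_simple fxy red1 tri e2D1 e2ab).
  + exact: (reduction_split G_simple kG fxy nxy red2 D12).
  + suff -> : [set e1; e2; f] = incident t by [].
    apply/eqP; rewrite eqEcard t3; apply/andP; split.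
      by apply/subsetP => e; rewrite !in_setU !in_set1 -orbA =>
        /or3P[]/eqP->; rewrite ?fT // DT.
    have fD := red_notin red.
    by rewrite setUC -DE cardsU1 fD DE cards2 ne12.
Qed.
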